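(* The following statements about a finite digraph $G$ are equivalent: (1) $\mathrm{MH}_{2,\ell}(G,\mathbb{Z})=0$ for all $\ell\neq2$; (2) $G$ satisfies property $(\mathcal{V}_2)$: any two shortest paths connecting the same vertices are $2$-shortly congruent, and any long path is $2$-quasi-reducible; (3) the distance algebra $\sigma G$ over $\mathbb{K}$ is quadratic for any field $\mathbb{K}$. Moreover, if these properties are satisfied, then $(\sigma G)^!\cong\Omega^\bullet(G^{op})$ for any field $\mathbb{K}$.
   Context: A digraph $G$ consists of a set of vertices and a set of arrows, which are ordered pairs of distinct vertices; $G^{op}$ has all arrows reversed. A path of length $n\ge 0$ is a tuple of vertices $p=(p_0,\dots,p_n)$ such that each $(p_i,p_{i+1})$ is an arrow; $d(x,y)$ is the infimum of lengths of paths from $x$ to $y$ ($\infty$ if there are none). A path is shortest if $d(p_0,p_n)=n$, and long otherwise. A subpath of $p$ is a path $(p_i,\dots,p_j)$. Paths connect the same vertices if they have the same initial and terminal vertices. Magnitude homology: put $|x_0,\dots,x_n|=\sum_{i=0}^{n-1}d(x_i,x_{i+1})$. $\mathrm{MC}_{n,\ell}(G,\mathbb{Z})$ is the free abelian group on tuples of vertices with $x_i\neq x_{i+1}$ and $|x_0,\dots,x_n|=\ell$; the differential is $\sum_i(-1)^i\partial_{n,i}$, where $\partial_{n,i}$ deletes $x_i$ if the resulting tuple still has norm $\ell$ and is $0$ otherwise. $\mathrm{MH}_{n,\ell}(G,\mathbb{Z})=H_n(\mathrm{MC}_{\bullet,\ell}(G,\mathbb{Z}))$. An equivalence relation $\sim$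 on paths is a congruence if $p\sim\tilde p$ implies that $p,\tilde p$ connect the same vertices and $qpq'\sim q\tilde pq'$ whenever the concatenations are defined. The $2$-short congruence is the minimal congruence such that any two shortest paths connecting the same two vertices at distance at most $2$ are equivalent. A long path is $2$-reducible if it contains a long subpath of length at most $2$, and $2$-quasi-reducible if it is $2$-shortly congruent to a $2$-reducible path. $\mathbb{K}G$ is the path algebra (free on all paths, product = concatenation or zero, graded by length). The distance algebra $\sigma G$ has $\mathbb{K}$-basis the pairs $(x,y)$ of vertices such that there is a path from $x$ to $y$, product $(x,y)(y',z)=(x,z)$ if $y=y'$ and $d(x,y)+d(y,z)=d(x,z)$ and $0$ otherwise, and degree $|(x,y)|=d(x,y)$. There is an isomorphism $\sigma G\cong\mathbb{K}G/R$, where $R$ is the ideal generated by differences of shortest paths connecting the same vertices and by long paths. For a field $\mathbb{K}$ and a finite quiver $Q$, a graded quiver algebra $A=\mathbb{K}Q/I$ ($I$ a homogeneous ideal with $I_0=I_1=0$, grading by path length) is quadratic if $I$ is generated by $I_2$. Its quadratic dual is $A^!=\mathbb{K}Q^{op}/I^\perp$, where $I^\perp$ is the ideal generated by the orthogonal complement $I_2^\perp\subseteq(\mathbb{K}Q^{op})_2$ of $I_2$ with respect to the bilinear form on $(\mathbb{K}Q)_2\times(\mathbb{K}Q^{op})_2$ with $\langle p,q\rangle=\delta_{p^{op},q}$ on paths. The path cochain algebra $\Omega^\bullet(G)$ is isomorphic as a graded algebra to $\mathbb{K}G/T$, where $T$ is the ideal generated by the elements $t_{x,y}=\sum_v(x,v,y)$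 for all pairs with $d(x,y)=2$, the sum running over all vertices $v$ such that $(x,v,y)$ is a path; here this may be taken as its definition. *)

(* Defs.v *)
From HB Require Import structures.
From mathcomp Require Import all_boot all_algebra.
From mathcomp Require Import ring_quotient generic_quotient.
From mathcomp Require Import boolp finmap.
From mathcomp.multinomials Require Import monalg.
Set Implicit Arguments. Unset Strict Implicit. Unset Printing Implicit Defensive.
Import GRing.Theory.
Local Open Scope ring_scope.
Local Open Scope quotient_scope.

Record digraph := Digraph {
  vertex :> finType;
  arrow : rel vertex;
  arrow_irr : irreflexive arrow
}.

Definition opdigraph (G : digraph) : digraph :=
  @Digraph G (fun x y => @arrow G y x) (@arrow_irr G).

(* The path (p_0, ..., p_n) is stored as the pair (p_0, [:: p_1; ...; p_n]). *)
Record gpath (G : digraph) := GPath {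
  pval : G * seq G;
  pvalP : path (@arrow G) pval.1 pval.2
}.
HB.instance Definition _ (G : digraph) := [isSub for @pval G].
HB.instance Definition _ (G : digraph) := [Choice of gpath G by <:].

Definition pstart (G : digraph) (p : gpath G) : G := (pval p).1.
Definition pend (G : digraph) (p : gpath G) : G := last (pval p).1 (pval p).2.
Definition plen (G : digraph) (p : gpath G) : nat := size (pval p).2.
Definition verts (G : digraph) (p : gpath G) : seq G := (pval p).1 :: (pval p).2.

Definition pcat (G : digraph) (p q : gpath G) : option (gpath G) :=
  if pend p == pstart q then insub (pstart p, (pval p).2 ++ (pval q).2) else None.

Definition has_path (G : digraph) (x y : G) (n : nat) : bool :=
  `[< exists p : gpath G, [/\ pstart p = x, pend p = y & plen p = n] >].

(* None stands for the infinite distance. *)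
Definition dist (G : digraph) (x y : G) : option nat :=
  match pselect (exists n, has_path x y n) with
  | left H => Some (ex_minn H)
  | right _ => None
  end.

Definition dadd (a b : option nat) : option nat :=
  if a is Some m then if b is Some n then Some (m + n)%N else None else None.

Definition connect_same (G : digraph) (p q : gpath G) : Prop :=
  pstart p = pstart q /\ pend p = pend q.

Definition shortest (G : digraph) (p : gpath G) : bool :=
  dist (pstart p) (pend p) == Some (plen p).
Notation long p := (~~ shortest p).

(* infix tests for a contiguous block of vertices (p_i, ..., p_j). *)
Definition subpath (G : digraph) (q p : gpath G) : bool := infix (verts q) (verts p).

Record congruence (G : digraph) (R : gpath G -> gpath G -> Prop) : Prop := {
  congr_refl : forall p, R p p;
  congr_sym : forall p q, R p q -> R q p;
  congr_trans : forall p q r, R p q -> R q r -> R p r;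
  congr_ends : forall p q, R p q -> connect_same p q;
  congr_cat : forall q p p' q' r r', R p p' ->
    obind (fun u => pcat u q') (pcat q p) = Some r ->
    obind (fun u => pcat u q') (pcat q p') = Some r' -> R r r'
}.

(* The minimal congruence, as the intersection of all the congruences that
   identify shortest paths with the same ends at distance at most 2. *)
Definition two_short (G : digraph) (p q : gpath G) : Prop :=
  forall R, congruence R ->
    (forall u v, shortest u -> shortest v -> connect_same u v ->
       (plen u <= 2)%N -> R u v) ->
    R p q.

Definition reducible2 (G : digraph) (p : gpath G) : Prop :=
  long p /\ exists q, [/\ subpath q p, long q & (plen q <= 2)%N].

Definition quasi_reducible2 (G : digraph) (p : gpath G) : Prop :=
  exists q, two_short p q /\ reducible2 q.

Definition property_V2 (G : digraph) : Prop :=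
  (forall p q : gpath G, shortest p -> shortest q -> connect_same p q ->
     two_short p q) /\
  (forall p : gpath G, long p -> quasi_reducible2 p).

Definition tnorm (G : digraph) (s : seq G) : option nat :=
  if s is x :: s' then foldr dadd (Some 0%N) (pairmap (@dist G) x s') else Some 0%N.

Definition mc_tuple (G : digraph) (n l : nat) (t : n.+1.-tuple G) : bool :=
  sorted (fun x y : G => x != y) t && (tnorm t == Some l).

Definition mc_gen (G : digraph) (n l : nat) := {t : n.+1.-tuple G | mc_tuple l t}.
Definition MC (G : digraph) (n l : nat) := {ffun mc_gen G n l -> int}.
HB.instance Definition _ (G : digraph) n l := GRing.Zmodule.on (MC G n l).

Definition del (T : Type) (n : nat) (i : 'I_n.+1) (t : n.+1.-tuple T) : n.-tuple T :=
  [tuple tnth t (lift i j) | j < n].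

(* insub returns None as soon as the norm is no longer l. It also tests that
   adjacent entries are distinct, which is automatic when the norm is still l:
   deleting x_i between equal neighbours lowers the norm by
   d(x_{i-1}, x_i) + d(x_i, x_{i+1}) > 0. *)
Definition face (G : digraph) (n l : nat) (i : 'I_n.+2) (t : mc_gen G n.+1 l) :
  option (mc_gen G n l) := insub (del i (val t)).

Definition MCd (G : digraph) (n l : nat) (c : MC G n.+1 l) : MC G n l :=
  [ffun u => \sum_t \sum_(i < n.+2 | face i t == Some u) (-1) ^+ i * c t].

Lemma MCd_zmod_morphism (G : digraph) (n l : nat) : zmod_morphism (@MCd G n l).
Proof.
move=> c c'; apply/ffunP => u; rewrite !ffunE -sumrB; apply: eq_bigr => t _.
by rewrite -sumrB; apply: eq_bigr => i _; rewrite !ffunE mulrBr.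
Qed.
HB.instance Definition _ (G : digraph) n l :=
  GRing.isZmodMorphism.Build (MC G n.+1 l) (MC G n l) (@MCd G n l)
    (@MCd_zmod_morphism G n l).

Definition mc_cycle (G : digraph) (n l : nat) : {pred MC G n l} :=
  match n with 0 => fun _ => true | m.+1 => fun c => MCd c == 0 end.

Lemma mc_cycle_zmod_closed (G : digraph) (n l : nat) : zmod_closed (@mc_cycle G n l).
Proof.
case: n => [|n]; split => //; first by rewrite unfold_in /= raddf0.
by move=> c c' /eqP Hc /eqP Hc'; apply/eqP; rewrite raddfB /= Hc Hc' subrr.
Qed.
HB.instance Definition _ (G : digraph) n l :=
  GRing.isZmodClosed.Build (MC G n l) (@mc_cycle G n l) (@mc_cycle_zmod_closed G n l).

Record MZ (G : digraph) (n l : nat) :=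
  Cycle { mc_val : MC G n l; mc_valP : mc_val \in @mc_cycle G n l }.
HB.instance Definition _ (G : digraph) n l := [isSub for @mc_val G n l].
HB.instance Definition _ (G : digraph) n l := [Choice of MZ G n l by <:].
HB.instance Definition _ (G : digraph) n l :=
  [SubChoice_isSubZmodule of MZ G n l by <:].

Definition mc_boundary (G : digraph) (n l : nat) : {pred MZ G n l} :=
  fun z => `[< exists c : MC G n.+1 l, MCd c = val z >].

Lemma mc_boundary_zmod_closed (G : digraph) (n l : nat) :
  zmod_closed (@mc_boundary G n l).
Proof.
split => [|z z']; first by apply/asboolP; exists 0; rewrite !raddf0.
move=> /asboolP [c Hc] /asboolP [c' Hc']; apply/asboolP; exists (c - c').
by rewrite !raddfB /= Hc Hc'.
Qed.
HB.instance Definition _ (G : digraph) n l :=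
  GRing.isZmodClosed.Build (MZ G n l) (@mc_boundary G n l)
    (@mc_boundary_zmod_closed G n l).

Definition MH (G : digraph) (n l : nat) := Quotient.quot (@mc_boundary G n l).
HB.instance Definition _ (G : digraph) n l := GRing.Zmodule.on (MH G n l).

(* MathComp's algType excludes the zero algebra, which occurs here for the empty
   digraph. A K-algebra is therefore given as a (possibly zero) ring A with a
   ring morphism kin from K to the centre of A; the scaling is k.x = kin k * x. *)
HB.mixin Record isGradedAlgebra (K : fieldType) A of GRing.PzRing A := {
  kin : K -> A;
  kin1 : kin 1 = 1;
  kinB : forall k l, kin (k - l) = kin k - kin l;
  kinM : forall k l, kin (k * l) = kin k * kin l;
  kinC : forall (k : K) (x : A), kin k * x = x * kin k;
  gr : nat -> A -> Prop;
  gr_sub0 : forall n, gr n 0;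
  grB : forall n (x y : A), gr n x -> gr n y -> gr n (x - y);
  gr_kin : forall k, gr 0%N (kin k);
  grM : forall m n (x y : A), gr m x -> gr n y -> gr (m + n)%N (x * y);
  gr_decomp : forall x : A, exists n, exists c : nat -> A,
    (forall i, gr i (c i)) /\ x = \sum_(i < n) c i;
  gr_direct : forall n (c : nat -> A), (forall i, gr i (c i)) ->
    \sum_(i < n) c i = 0 -> forall i, (i < n)%N -> c i = 0
}.
#[short(type="grAlgType")]
HB.structure Definition GradedAlgebra (K : fieldType) :=
  {A of isGradedAlgebra K A & GRing.PzRing A}.

Definition gr_iso (K : fieldType) (A B : grAlgType K) : Prop :=
  exists f : {rmorphism A -> B},
    [/\ forall k : K, f (kin k) = kin k, bijective f &
        forall n x, gr n x <-> gr n (f x)].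

Definition is_ideal (R : pzRingType) (I : R -> Prop) : Prop :=
  [/\ I 0, forall x y, I x -> I y -> I (x + y) &
      forall a x b, I x -> I (a * x * b)].

Definition ideal_gen (R : pzRingType) (S : R -> Prop) (x : R) : Prop :=
  forall I, is_ideal I -> (forall s, S s -> I s) -> I x.

Definition homogeneous (K : fieldType) (A : grAlgType K) (I : A -> Prop) : Prop :=
  forall n (c : nat -> A), (forall i, gr i (c i)) ->
    I (\sum_(i < n) c i) -> forall i, (i < n)%N -> I (c i).

Record hideal (K : fieldType) (A : grAlgType K) := HIdeal {
  hset :> A -> Prop;
  hidealP : is_ideal hset;
  hhomP : homogeneous hset
}.

Section GradedTheory.
Variables (K : fieldType) (A : grAlgType K).
Implicit Types (I : A -> Prop) (S : A -> Prop).

Lemma gr_sum (J : Type) (s : seq J) (P : pred J) (F : J -> A) n :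
  (forall j, P j -> gr n (F j)) -> gr n (\sum_(j <- s | P j) F j).
Proof.
move=> H; apply: big_ind => //; first exact: gr_sub0.
by move=> x y Hx Hy; rewrite -[y]opprK; apply: grB => //; rewrite -sub0r; apply: grB => //;
   exact: gr_sub0.
Qed.

Lemma ideal_sum I (J : Type) (s : seq J) (P : pred J) (F : J -> A) :
  is_ideal I -> (forall j, P j -> I (F j)) -> I (\sum_(j <- s | P j) F j).
Proof. by case=> I0 ID _ H; apply: big_ind. Qed.

Lemma idealMl I a x : is_ideal I -> I x -> I (a * x).
Proof. by case=> _ _ IM Hx; rewrite -[a * x]mulr1; exact: IM. Qed.

Lemma idealMr I a x : is_ideal I -> I x -> I (x * a).
Proof. by case=> _ _ IM Hx; rewrite -[x]mul1r; exact: IM. Qed.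

Lemma idealN I x : is_ideal I -> I x -> I (- x).
Proof. by move=> HI Hx; rewrite -mulN1r; exact: idealMl. Qed.

Lemma idealB I x y : is_ideal I -> I x -> I y -> I (x - y).
Proof. by move=> HI Hx Hy; case: (HI) => _ ID _; apply: ID => //; apply: idealN. Qed.

Lemma ideal_gen_ideal S : is_ideal (ideal_gen S).
Proof.
split=> [I [] //|x y Hx Hy I HI HS|a x b Hx I HI HS].
  by case: (HI) => _ ID _; apply: ID; [exact: Hx|exact: Hy].
by case: (HI) => _ _; apply; exact: Hx.
Qed.

Lemma ideal_gen_sub S x : S x -> ideal_gen S x.
Proof. by move=> Hx I _; apply. Qed.

Lemma gen_homogeneous S :
  (forall s, S s -> exists n, gr n s) -> homogeneous (ideal_gen S).
Proof.
move=> HS.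
have [G0 GD GM] := ideal_gen_ideal S.
pose J x := exists s : seq (nat * A),
  (forall u, u \in s -> gr u.1 u.2 /\ ideal_gen S u.2) /\ x = \sum_(u <- s) u.2.
have JD x y : J x -> J y -> J (x + y).
  move=> [s [Hs ->]] [t [Ht ->]]; exists (s ++ t); rewrite big_cat; split=> // u.
  by rewrite mem_cat => /orP [/Hs|/Ht].
have J0 : J 0 by exists [::]; rewrite big_nil; split.
have Jsum (T : eqType) (r : seq T) (F : T -> A) :
    (forall i, i \in r -> J (F i)) -> J (\sum_(i <- r) F i).
  by move=> H; rewrite big_seq; apply: big_ind.
have Jhom n x : gr n x -> ideal_gen S x -> J x.
  move=> H1 H2; exists [:: (n, x)]; rewrite big_seq1; split=> // u.
  by rewrite inE => /eqP ->.
have HJ : is_ideal J.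
  split=> // a x b [s [Hs ->]].
  have [m [c [Hc ->]]] := gr_decomp a.
  have [m' [c' [Hc' ->]]] := gr_decomp b.
  rewrite !mulr_suml; apply: (Jsum) => i _.
  rewrite [c i * _]mulr_sumr mulr_suml; apply: (Jsum) => u /Hs [Hu1 Hu2].
  rewrite mulr_sumr; apply: Jsum => j _.
  apply: (Jhom (i + u.1 + j)%N); last exact: GM.
  by apply: grM => //; apply: grM.
move=> n c Hc /(_ J HJ) [].
  by move=> s Hs; have [m Hm] := HS s Hs; apply: (Jhom m) => //; exact: ideal_gen_sub.
move=> s [Hs E] i Hi.
have Ds u : u \in s -> gr u.1 u.2 by case/Hs.
pose d j := \sum_(u <- s | u.1 == j) u.2.
have Gd j : gr j (d j).
  by rewrite /d big_seq_cond; apply: gr_sum => u /andP [/Ds Hu /eqP <-].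
have Id j : ideal_gen S (d j).
  rewrite /d big_seq_cond; apply: ideal_sum; first exact: ideal_gen_ideal.
  by move=> u /andP [/Hs []].
pose N := (n + \max_(u <- s) u.1.+1)%N.
pose e j := (if (j < n)%N then c j else 0) - d j.
have Ge j : gr j (e j) by apply: grB => //; case: ifP => // _; exact: gr_sub0.
have Es : \sum_(j < N) e j = 0.
  rewrite sumrB; apply/eqP; rewrite subr_eq0; apply/eqP.
  transitivity (\sum_(i < n) c i).
    by rewrite (big_ord_widen N c (leq_addr _ _)) [RHS]big_mkcond.
  rewrite E /d (exchange_big_dep xpredT) //= big_seq [RHS]big_seq.
  apply: eq_bigr => u us.
  have uN : (u.1 < N)%N.
    apply: leq_trans (leq_addl _ _).
    by apply: (@leq_bigmax_seq _ s xpredT (fun v : nat * A => v.1.+1)).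
  by rewrite (big_pred1 (Ordinal uN)) // => j; rewrite eq_sym.
have iN : (i < N)%N by apply: leq_trans Hi (leq_addr _ _).
by have /eqP := gr_direct N e Ge Es i iN; rewrite /e Hi subr_eq0 => /eqP ->.
Qed.

End GradedTheory.

Definition gen_hideal (K : fieldType) (A : grAlgType K) (S : A -> Prop)
    (HS : forall s, S s -> exists n, gr n s) : hideal A :=
  HIdeal (ideal_gen_ideal S) (gen_homogeneous HS).

Section QuotientAlgebra.
Variables (K : fieldType) (A : grAlgType K) (I : hideal A).

Definition hmem : {pred A} := fun x => `[< I x >].

Lemma hmem_zmod_closed : zmod_closed hmem.
Proof.
split; first by apply/asboolP; case: (hidealP I).
by move=> x y /asboolP Hx /asboolP Hy; apply/asboolP; exact: (idealB (hidealP I)).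
Qed.
HB.instance Definition _ := GRing.isZmodClosed.Build A hmem hmem_zmod_closed.

Definition quotalg := Quotient.quot hmem.
HB.instance Definition _ := GRing.Zmodule.on quotalg.
HB.instance Definition _ := ZmodQuotient.on quotalg.

Definition qpi (x : A) : quotalg := \pi_(quotalg) x.

Lemma qpiB x y : qpi (x - y) = qpi x - qpi y.
Proof. exact: raddfB. Qed.

Lemma qpi_eq x y : qpi x = qpi y <-> I (x - y).
Proof.
rewrite /qpi; split.
  by move/eqP; rewrite -Quotient.idealrBE => /asboolP.
by move=> H; apply/eqP; rewrite -Quotient.idealrBE; apply/asboolP.
Qed.

Lemma qpi_repr (u : quotalg) : qpi (repr u) = u.
Proof. exact: reprK. Qed.

Definition qone : quotalg := qpi 1.
Definition qmul (u v : quotalg) : quotalg := qpi (repr u * repr v).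

Lemma qpiM x y : qpi (x * y) = qmul (qpi x) (qpi y).
Proof.
rewrite /qmul; set x' := repr _; set y' := repr _.
have Hx : I (x - x') by apply/qpi_eq; rewrite qpi_repr.
have Hy : I (y - y') by apply/qpi_eq; rewrite qpi_repr.
apply/qpi_eq; have -> : x * y - x' * y' = (x - x') * y + x' * (y - y').
  by rewrite mulrBl mulrBr addrA subrK.
have HI := hidealP I; case: (HI) => _ ID _.
by apply: ID; [exact: idealMr|exact: idealMl].
Qed.

Lemma qpiD x y : qpi (x + y) = qpi x + qpi y.
Proof. exact: raddfD. Qed.

Lemma qmulA : associative qmul.
Proof.
move=> u v w; rewrite -(qpi_repr u) -(qpi_repr v) -(qpi_repr w).
by rewrite -!qpiM mulrA.
Qed.
Lemma qmul1 : left_id qone qmul.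
Proof. by move=> u; rewrite -(qpi_repr u) -!qpiM mul1r. Qed.
Lemma qmulr1 : right_id qone qmul.
Proof. by move=> u; rewrite -(qpi_repr u) -!qpiM mulr1. Qed.
Lemma qmulDl : left_distributive qmul +%R.
Proof.
move=> u v w; rewrite -(qpi_repr u) -(qpi_repr v) -(qpi_repr w).
by rewrite -qpiD -!qpiM -qpiD mulrDl.
Qed.
Lemma qmulDr : right_distributive qmul +%R.
Proof.
move=> u v w; rewrite -(qpi_repr u) -(qpi_repr v) -(qpi_repr w).
by rewrite -qpiD -!qpiM -qpiD mulrDr.
Qed.
HB.instance Definition _ := GRing.Zmodule_isPzRing.Build quotalg
  qmulA qmul1 qmulr1 qmulDl qmulDr.

Lemma qpi_rM x y : qpi (x * y) = qpi x * qpi y.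
Proof. exact: qpiM. Qed.
Lemma qpi0 : qpi 0 = 0. Proof. exact: raddf0. Qed.
Lemma qpi1 : qpi 1 = 1. Proof. by []. Qed.
Lemma qpi_sum (J : Type) (s : seq J) (F : J -> A) :
  qpi (\sum_(j <- s) F j) = \sum_(j <- s) qpi (F j).
Proof. exact: raddf_sum. Qed.

Definition qgr (n : nat) (u : quotalg) : Prop := exists2 x, gr n x & qpi x = u.

Fact q_kin1 : qpi (kin 1) = 1. Proof. by rewrite kin1. Qed.
Fact q_kinB k l : qpi (kin (k - l)) = qpi (kin k) - qpi (kin l).
Proof. by rewrite kinB qpiB. Qed.
Fact q_kinM k l : qpi (kin (k * l)) = qpi (kin k) * qpi (kin l).
Proof. by rewrite kinM qpi_rM. Qed.
Fact q_kinC k (u : quotalg) : qpi (kin k) * u = u * qpi (kin k).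
Proof. by rewrite -(qpi_repr u) -!qpi_rM kinC. Qed.
Fact q_sub0 n : qgr n 0.
Proof. by exists 0; [exact: gr_sub0 | rewrite qpi0]. Qed.
Fact q_grB n (u v : quotalg) : qgr n u -> qgr n v -> qgr n (u - v).
Proof. by move=> [x Hx <-] [y Hy <-]; exists (x - y); [exact: grB|rewrite qpiB]. Qed.
Fact q_kingr k : qgr 0 (qpi (kin k)).
Proof. by exists (kin k) => //; exact: gr_kin. Qed.
Fact q_grM m n (u v : quotalg) : qgr m u -> qgr n v -> qgr (m + n) (u * v).
Proof. by move=> [x Hx <-] [y Hy <-]; exists (x * y); [exact: grM|rewrite qpi_rM]. Qed.
Fact q_decomp (u : quotalg) : exists n, exists c : nat -> quotalg,
  (forall i, qgr i (c i)) /\ u = \sum_(i < n) c i.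
Proof.
have [n [c [Hc E]]] := gr_decomp (repr u).
exists n, (fun i => qpi (c i)); split=> [i|]; first by exists (c i).
by rewrite -qpi_sum -E qpi_repr.
Qed.
Fact q_direct n (c : nat -> quotalg) : (forall i, qgr i (c i)) ->
  \sum_(i < n) c i = 0 -> forall i, (i < n)%N -> c i = 0.
Proof.
move=> Hc E i Hi.
have /choice [d Hd] : forall i, exists x, gr i x /\ qpi x = c i.
  by move=> j; have [x Hx1 Hx2] := Hc j; exists x.
have Gd j : gr j (d j) by case: (Hd j).
have <- : qpi (d i) = c i by case: (Hd i).
have Ed : I (\sum_(i < n) d i).
  rewrite -[X in I X]subr0; apply/qpi_eq; rewrite qpi0 qpi_sum -[RHS]E.
  by apply: eq_bigr => j _; case: (Hd j).
rewrite -qpi0; apply/qpi_eq; rewrite subr0.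
exact: (hhomP Gd Ed).
Qed.
HB.instance Definition _ := isGradedAlgebra.Build K quotalg
  q_kin1 q_kinB q_kinM q_kinC q_sub0 q_grB q_kingr q_grM q_decomp q_direct.

End QuotientAlgebra.

(* The product of two basis elements is a basis element or zero (None); the sum
   of the elements of pb_unit is the unit of the algebra. *)
Record pbasis := PBasis {
  pb_sort :> choiceType;
  pb_mul : pb_sort -> pb_sort -> option pb_sort;
  pb_deg : pb_sort -> nat;
  pb_unit : seq pb_sort;
  pb_left : pb_sort -> pb_sort;
  pb_right : pb_sort -> pb_sort;
  pb_mulA : forall a b c,
    obind (fun u => pb_mul u c) (pb_mul a b) = obind (pb_mul a) (pb_mul b c);
  pb_uniq : uniq pb_unit;
  pb_leftP : forall b, pb_left b \in pb_unit;
  pb_rightP : forall b, pb_right b \in pb_unit;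
  pb_mul1 : forall e b, e \in pb_unit ->
    pb_mul e b = if e == pb_left b then Some b else None;
  pb_mulr1 : forall e b, e \in pb_unit ->
    pb_mul b e = if e == pb_right b then Some b else None;
  pb_degM : forall a b c, pb_mul a b = Some c -> pb_deg c = (pb_deg a + pb_deg b)%N;
  pb_deg1 : forall e, e \in pb_unit -> pb_deg e = 0%N
}.

Section LinearExtension.
Variables (K : fieldType) (B : choiceType).

Definition lext (V : lmodType K) (h : B -> V) (x : {malg K[B]}) : V :=
  \sum_(b <- msupp x) x@_b *: h b.

Lemma lextEw (V : lmodType K) (h : B -> V) (x : {malg K[B]}) (D : {fset B}) :
  (msupp x `<=` D)%fset -> lext h x = \sum_(b <- D) x@_b *: h b.
Proof.
move=> le; rewrite /lext; apply: big_fset_incl => //.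
by move=> b _ /mcoeff_outdom ->; rewrite scale0r.
Qed.

Lemma lext_linear (V : lmodType K) (h : B -> V) : linear (lext h).
Proof.
move=> k x y; pose D := (msupp x `|` msupp y)%fset.
rewrite (@lextEw _ h (k *: x + y) D); last first.
  apply: fsubset_trans (msuppD_le _ _) _; apply: fsetSU; exact: msuppZ_le.
rewrite (@lextEw _ h x D) ?fsubsetUl // (@lextEw _ h y D) ?fsubsetUr //.
rewrite scaler_sumr -big_split; apply: eq_bigr => b _ /=.
by rewrite mcoeffD mcoeffZ scalerDl scalerA.
Qed.
HB.instance Definition _ (V : lmodType K) (h : B -> V) :=
  GRing.isLinear.Build K {malg K[B]} V *:%R (lext h) (lext_linear h).

Lemma lextU (V : lmodType K) (h : B -> V) b : lext h << b >> = h b.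
Proof. by rewrite /lext msuppU oner_eq0 big_seq_fset1 mcoeffUU scale1r. Qed.

Lemma malg_ind (P : {malg K[B]} -> Prop) :
  P 0 -> (forall x y, P x -> P y -> P (x + y)) ->
  (forall k b, P (k *: << b >>)) -> forall x, P x.
Proof.
move=> P0 PD PZ x; rewrite (monalgE x); apply: big_ind => // b _.
suff -> : << x@_b *g b >> = x@_b *: << b >> :> {malg K[B]} by [].
by apply/malgP => a; rewrite mcoeffZ !mcoeffU mulrnAr mulr1.
Qed.

Lemma lext_id (x : {malg K[B]}) : lext (fun b => << b >> : {malg K[B]}) x = x.
Proof.
elim/malg_ind: x => [|x y Hx Hy|k b]; first by rewrite linear0.
  by rewrite linearD /= Hx Hy.
by rewrite linearZ /= lextU.
Qed.
End LinearExtension.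

Section BasisAlgebra.
Variables (K : fieldType) (B : pbasis).
Local Notation A := {malg K[B]}.

Definition bas (b : B) : A := << b >>.
Definition obas (b : option B) : A := if b is Some c then bas c else 0.

Definition bmul (x y : A) : A :=
  lext (fun a => lext (fun b => obas (pb_mul a b)) y) x.
Definition bone : A := \sum_(e <- pb_unit B) bas e.

Lemma bmulDl : left_distributive bmul +%R.
Proof. by move=> x y z; rewrite /bmul linearD. Qed.
Lemma bmulZl k x y : bmul (k *: x) y = k *: bmul x y.
Proof. by rewrite /bmul linearZ. Qed.
Lemma bmulZr k x y : bmul x (k *: y) = k *: bmul x y.
Proof.
rewrite /bmul /lext scaler_sumr; apply: eq_bigr => a _.
by rewrite -/(lext _ (k *: y)) linearZ /= scalerA mulrC -scalerA.
Qed.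
Lemma bmulDr : right_distributive bmul +%R.
Proof.
move=> x y z; rewrite /bmul {1 3 5}/lext -big_split; apply: eq_bigr => a _ /=.
by rewrite linearD scalerDr.
Qed.
Lemma bmul0 x : bmul 0 x = 0. Proof. by rewrite /bmul linear0. Qed.
Lemma bmulr0 x : bmul x 0 = 0.
Proof. by rewrite -[X in bmul x X](scale0r (0 : A)) bmulZr scale0r. Qed.
Lemma bmulU a b : bmul (bas a) (bas b) = obas (pb_mul a b).
Proof. by rewrite /bmul /bas !lextU. Qed.

Lemma bmulA : associative bmul.
Proof.
move=> x y z.
elim/malg_ind: x => [|x x' Hx Hx'|k a]; first by rewrite !bmul0.
  by rewrite !bmulDl Hx Hx'.
rewrite !bmulZl; congr (_ *: _).
elim/malg_ind: y => [|y y' Hy Hy'|l b]; first by rewrite !bmulr0 !bmul0 bmulr0.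
  by rewrite !(bmulDl, bmulDr) Hy Hy'.
rewrite !(bmulZl, bmulZr); congr (_ *: _).
elim/malg_ind: z => [|z z' Hz Hz'|m c]; first by rewrite !bmulr0.
  by rewrite !bmulDr Hz Hz'.
rewrite !bmulZr; congr (_ *: _); rewrite -!/(bas _) !bmulU.
have := pb_mulA a b c.
case: (pb_mul a b) => [u|]; case: (pb_mul b c) => [v|] /= E;
  rewrite ?bmul0 ?bmulr0 ?bmulU //.
- by rewrite E.
- by rewrite E.
- by rewrite -E.
Qed.

Lemma bmul_suml (s : seq B) (y : A) :
  bmul (\sum_(e <- s) bas e) y = \sum_(e <- s) bmul (bas e) y.
Proof.
by elim: s => [|e s IH]; rewrite ?(big_nil, big_cons) ?bmul0 // bmulDl IH.
Qed.
Lemma bmul_sumr (s : seq B) (y : A) :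
  bmul y (\sum_(e <- s) bas e) = \sum_(e <- s) bmul y (bas e).
Proof.
by elim: s => [|e s IH]; rewrite ?(big_nil, big_cons) ?bmulr0 // bmulDr IH.
Qed.

Lemma bmul1 : left_id bone bmul.
Proof.
move=> x; elim/malg_ind: x => [|x y Hx Hy|k b]; first by rewrite bmulr0.
  by rewrite bmulDr Hx Hy.
rewrite bmulZr; congr (_ *: _); rewrite bmul_suml.
rewrite (bigD1_seq _ (pb_leftP b) (pb_uniq B)) /= -/(bas b) bmulU.
rewrite pb_mul1 ?pb_leftP // eqxx /= big_seq_cond big1 ?addr0 // => e /andP [He Hn].
by rewrite bmulU pb_mul1 // (negbTE Hn).
Qed.
Lemma bmulr1 : right_id bone bmul.
Proof.
move=> x; elim/malg_ind: x => [|x y Hx Hy|k b]; first by rewrite bmul0.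
  by rewrite bmulDl Hx Hy.
rewrite bmulZl; congr (_ *: _); rewrite bmul_sumr.
rewrite (bigD1_seq _ (pb_rightP b) (pb_uniq B)) /= -/(bas b) bmulU.
rewrite pb_mulr1 ?pb_rightP // eqxx /= big_seq_cond big1 ?addr0 // => e /andP [He Hn].
by rewrite bmulU pb_mulr1 // (negbTE Hn).
Qed.

Definition bgr (n : nat) (x : A) : Prop := forall b, b \in msupp x -> pb_deg b = n.

Lemma bgrP n (x : A) : bgr n x <-> forall b, pb_deg b <> n -> x@_b = 0.
Proof.
split=> H b.
  by move=> Hb; apply/eqP; rewrite mcoeff_eq0; apply/negP => /H.
by rewrite -mcoeff_neq0 => /eqP Hb; apply: contrapT => /H.
Qed.

Lemma bgr_bas b : bgr (pb_deg b) (bas b).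
Proof. by move=> a; rewrite msuppU oner_eq0 inE => /eqP ->. Qed.

Fact b_sub0 n : bgr n 0. Proof. by apply/bgrP => b _; rewrite mcoeff0. Qed.
Fact b_grB n (x y : A) : bgr n x -> bgr n y -> bgr n (x - y).
Proof.
move=> /bgrP Hx /bgrP Hy; apply/bgrP => b Hb.
by rewrite mcoeffB Hx // Hy // subr0.
Qed.
Lemma bgrD n (x y : A) : bgr n x -> bgr n y -> bgr n (x + y).
Proof.
move=> /bgrP Hx /bgrP Hy; apply/bgrP => b Hb.
by rewrite mcoeffD Hx // Hy // addr0.
Qed.
Lemma bgrZ n k (x : A) : bgr n x -> bgr n (k *: x).
Proof. by move=> /bgrP Hx; apply/bgrP => b Hb; rewrite mcoeffZ Hx // mulr0. Qed.
Lemma bgr_sum n (J : Type) (s : seq J) (P : pred J) (F : J -> A) :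
  (forall j, P j -> bgr n (F j)) -> bgr n (\sum_(j <- s | P j) F j).
Proof. by move=> H; apply: big_ind => //; [exact: b_sub0|exact: bgrD]. Qed.

Lemma balgE (x : A) : x = \sum_(b <- msupp x) x@_b *: bas b.
Proof. by rewrite -[LHS]lext_id. Qed.

Definition bkin (k : K) : A := k *: bone.
Fact b_kingr k : bgr 0 (bkin k).
Proof.
apply: bgrZ; rewrite /bone big_seq; apply: bgr_sum => e He.
by rewrite -(pb_deg1 He); exact: bgr_bas.
Qed.
Fact b_grM m n (x y : A) : bgr m x -> bgr n y -> bgr (m + n) (bmul x y).
Proof.
move=> Hx Hy; rewrite /bmul /lext big_seq; apply: bgr_sum => a /Hx Ha.
apply: bgrZ; rewrite big_seq; apply: bgr_sum => b /Hy Hb.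
apply: bgrZ; case E: (pb_mul a b) => [c|]; last exact: b_sub0.
by rewrite -Ha -Hb -(pb_degM E); exact: bgr_bas.
Qed.

Definition bcomp (n : nat) (x : A) : A :=
  \sum_(b <- msupp x | pb_deg b == n) x@_b *: bas b.
Lemma bcomp_gr n (x : A) : bgr n (bcomp n x).
Proof.
by apply: bgr_sum => b /eqP <-; apply: bgrZ; exact: bgr_bas.
Qed.
Fact b_decomp (x : A) : exists n, exists c : nat -> A,
  (forall i, bgr i (c i)) /\ x = \sum_(i < n) c i.
Proof.
exists (\max_(b <- msupp x) (pb_deg b).+1), (fun i => bcomp i x).
split=> [i|]; first exact: bcomp_gr.
rewrite {1}(balgE x) /bcomp (exchange_big_dep xpredT) //= big_seq [RHS]big_seq.
apply: eq_bigr => b bx.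
have bN : (pb_deg b < \max_(b <- msupp x) (pb_deg b).+1)%N.
  by apply: (@leq_bigmax_seq _ _ xpredT (fun b : B => (pb_deg b).+1)).
by rewrite (big_pred1 (Ordinal bN)) // => j; rewrite eq_sym.
Qed.
Fact b_direct n (c : nat -> A) : (forall i, bgr i (c i)) ->
  \sum_(i < n) c i = 0 -> forall i, (i < n)%N -> c i = 0.
Proof.
move=> Hc E i Hi; apply/malgP => b; rewrite mcoeff0.
have [Hb|/eqP Hb] := eqVneq (pb_deg b) i; last by move/bgrP: (Hc i); apply.
have := congr1 (mcoeff b) E; rewrite raddf_sum mcoeff0 (bigD1 (Ordinal Hi)) //=.
rewrite big1 ?addr0 // => j Hj; move/bgrP: (Hc j); apply => Hbj.
by case/eqP: Hj; apply: val_inj; rewrite /= -Hb -Hbj.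
Qed.
End BasisAlgebra.

(* The operations are locked to keep unification from unfolding them down to malg. *)
Record galg (K : fieldType) (B : pbasis) := GAlg { gval : {malg K[B]} }.
HB.instance Definition _ K B := [isNew for @gval K B].
HB.instance Definition _ K B := [Choice of galg K B by <:].

HB.lock Definition galg_zero (K : fieldType) (B : pbasis) : galg K B := GAlg 0.
HB.lock Definition galg_opp (K : fieldType) (B : pbasis) (x : galg K B) : galg K B :=
  GAlg (- gval x).
HB.lock Definition galg_add (K : fieldType) (B : pbasis) (x y : galg K B) : galg K B :=
  GAlg (gval x + gval y).
HB.lock Definition galg_one (K : fieldType) (B : pbasis) : galg K B := GAlg (bone K B).
HB.lock Definition galg_mul (K : fieldType) (B : pbasis) (x y : galg K B) : galg K B :=
  GAlg (bmul (gval x) (gval y)).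
HB.lock Definition galg_kin (K : fieldType) (B : pbasis) (k : K) : galg K B :=
  GAlg (bkin B k).
HB.lock Definition galg_gr (K : fieldType) (B : pbasis) (n : nat) (x : galg K B) : Prop :=
  forall b, b \in msupp (gval x) -> pb_deg b = n.
HB.lock Definition gbas (K : fieldType) (B : pbasis) (b : B) : galg K B := GAlg << b >>.
HB.lock Definition coef (K : fieldType) (B : pbasis) (b : B) (x : galg K B) : K :=
  (gval x)@_b.
HB.lock Definition supp (K : fieldType) (B : pbasis) (x : galg K B) : seq B :=
  msupp (gval x).

Section BasisAlgebraStructure.
Variables (K : fieldType) (B : pbasis).
Local Notation A := (galg K B).
Local Notation add := (@galg_add K B).
Local Notation opp := (@galg_opp K B).
Local Notation mul := (@galg_mul K B).

Lemma gvalK (x y : A) : gval x = gval y -> x = y. Proof. exact: val_inj. Qed.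

Fact galg_addA : associative add.
Proof. by move=> x y z; apply: gvalK; rewrite !unlock /= addrA. Qed.
Fact galg_addC : commutative add.
Proof. by move=> x y; apply: gvalK; rewrite !unlock /= addrC. Qed.
Fact galg_add0 : left_id (galg_zero K B) add.
Proof. by move=> x; apply: gvalK; rewrite !unlock /= add0r. Qed.
Fact galg_addN : left_inverse (galg_zero K B) opp add.
Proof. by move=> x; apply: gvalK; rewrite !unlock /= addNr. Qed.
HB.instance Definition _ := GRing.isZmodule.Build A
  galg_addA galg_addC galg_add0 galg_addN.

Lemma gval0 : gval (0 : A) = 0. Proof. by rewrite -[0]/(galg_zero K B) unlock. Qed.
Lemma gvalN (x : A) : gval (- x) = - gval x.
Proof. by rewrite -[- x]/(opp x) unlock. Qed.
Lemma gvalD (x y : A) : gval (x + y) = gval x + gval y.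
Proof. by rewrite -[x + y]/(add x y) unlock. Qed.
Lemma gvalB (x y : A) : gval (x - y) = gval x - gval y.
Proof. by rewrite gvalD gvalN. Qed.
Lemma gval_sum (J : Type) (s : seq J) (P : pred J) (F : J -> A) :
  gval (\sum_(j <- s | P j) F j) = \sum_(j <- s | P j) gval (F j).
Proof. exact: (big_morph _ gvalD gval0). Qed.

Fact galg_mulA : associative mul.
Proof. by move=> x y z; apply: gvalK; rewrite !unlock /= bmulA. Qed.
Fact galg_mul1 : left_id (galg_one K B) mul.
Proof. by move=> x; apply: gvalK; rewrite !unlock /= bmul1. Qed.
Fact galg_mulr1 : right_id (galg_one K B) mul.
Proof. by move=> x; apply: gvalK; rewrite !unlock /= bmulr1. Qed.
Fact galg_mulDl : left_distributive mul +%R.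
Proof. by move=> x y z; apply: gvalK; rewrite gvalD !unlock /= gvalD bmulDl. Qed.
Fact galg_mulDr : right_distributive mul +%R.
Proof. by move=> x y z; apply: gvalK; rewrite gvalD !unlock /= gvalD bmulDr. Qed.
HB.instance Definition _ := GRing.Zmodule_isPzRing.Build A
  galg_mulA galg_mul1 galg_mulr1 galg_mulDl galg_mulDr.

Lemma gval1 : gval (1 : A) = bone K B. Proof. by rewrite -[1]/(galg_one K B) unlock. Qed.
Lemma gvalM (x y : A) : gval (x * y) = bmul (gval x) (gval y).
Proof. by rewrite -[x * y]/(mul x y) unlock. Qed.
Lemma gval_kin k : gval (galg_kin B k) = k *: bone K B.
Proof. by rewrite unlock. Qed.
Lemma galg_grE n (x : A) : galg_gr n x = bgr n (gval x).
Proof. by rewrite unlock. Qed.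

Fact g_kin1 : galg_kin B (1 : K) = 1.
Proof. by apply: gvalK; rewrite gval_kin scale1r gval1. Qed.
Fact g_kinB (k l : K) : galg_kin B (k - l) = galg_kin B k - galg_kin B l.
Proof. by apply: gvalK; rewrite gvalB !gval_kin scalerBl. Qed.
Lemma gval_kinM k (x : A) : gval (galg_kin B k * x) = k *: gval x.
Proof. by rewrite gvalM gval_kin bmulZl bmul1. Qed.
Fact g_kinM (k l : K) : galg_kin B (k * l) = galg_kin B k * galg_kin B l.
Proof. by apply: gvalK; rewrite gval_kinM !gval_kin scalerA. Qed.
Fact g_kinC k (x : A) : galg_kin B k * x = x * galg_kin B k.
Proof. by apply: gvalK; rewrite gval_kinM gvalM gval_kin bmulZr bmulr1. Qed.
Fact g_sub0 n : galg_gr n (0 : A).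
Proof. by rewrite galg_grE gval0; exact: b_sub0. Qed.
Fact g_grB n (x y : A) : galg_gr n x -> galg_gr n y -> galg_gr n (x - y).
Proof. by rewrite !galg_grE gvalB; exact: b_grB. Qed.
Fact g_kingr (k : K) : galg_gr 0 (galg_kin B k).
Proof. by rewrite galg_grE gval_kin; exact: b_kingr. Qed.
Fact g_grM m n (x y : A) : galg_gr m x -> galg_gr n y -> galg_gr (m + n) (x * y).
Proof. by rewrite !galg_grE gvalM; exact: b_grM. Qed.
Fact g_decomp (x : A) : exists n, exists c : nat -> A,
  (forall i, galg_gr i (c i)) /\ x = \sum_(i < n) c i.
Proof.
have [n [c [Hc E]]] := b_decomp (gval x).
exists n, (fun i => GAlg (c i)); split=> [i|]; first by rewrite galg_grE.
by apply: gvalK; rewrite gval_sum.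
Qed.
Fact g_direct n (c : nat -> A) : (forall i, galg_gr i (c i)) ->
  \sum_(i < n) c i = 0 -> forall i, (i < n)%N -> c i = 0.
Proof.
move=> Hc E i Hi; apply: gvalK; rewrite gval0.
apply: (@b_direct K B n (fun i => gval (c i))) => // [j|]; first by rewrite -galg_grE.
by rewrite -gval_sum E gval0.
Qed.
HB.instance Definition _ := isGradedAlgebra.Build K A
  g_kin1 g_kinB g_kinM g_kinC g_sub0 g_grB g_kingr g_grM g_decomp g_direct.

Implicit Types (x y : A) (b c : B).

Lemma gval_bas b : gval (gbas K b) = bas K b. Proof. by rewrite unlock. Qed.
Lemma coefE b x : coef b x = (gval x)@_b. Proof. by rewrite unlock. Qed.
Lemma suppE x : supp x = msupp (gval x). Proof. by rewrite unlock. Qed.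
Lemma grP n x : gr n x <-> forall b, b \in supp x -> pb_deg b = n.
Proof. by rewrite -[gr n x]/(galg_gr n x) suppE galg_grE. Qed.
Lemma gval_kinE k x : gval (kin k * x) = k *: gval x.
Proof. exact: gval_kinM. Qed.

Lemma coef_supp b x : (coef b x != 0) = (b \in supp x).
Proof. by rewrite coefE suppE mcoeff_neq0. Qed.
Lemma galgP x y : (forall b, coef b x = coef b y) -> x = y.
Proof. by move=> H; apply/gvalK/malgP => b; rewrite -!coefE. Qed.
Lemma coef0 b : coef b (0 : A) = 0. Proof. by rewrite coefE gval0 mcoeff0. Qed.
Lemma coefD b x y : coef b (x + y) = coef b x + coef b y.
Proof. by rewrite !coefE gvalD mcoeffD. Qed.
Lemma coefB b x y : coef b (x - y) = coef b x - coef b y.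
Proof. by rewrite !coefE gvalB mcoeffB. Qed.
Lemma coef_kin b k x : coef b (kin k * x) = k * coef b x.
Proof. by rewrite !coefE gval_kinE mcoeffZ. Qed.
Lemma coef_bas b c : coef b (gbas K c) = (c == b)%:R.
Proof. by rewrite coefE gval_bas mcoeffU. Qed.
Lemma gbasM b c :
  gbas K b * gbas K c = if pb_mul b c is Some d then gbas K d else 0.
Proof.
apply: gvalK; rewrite gvalM !gval_bas bmulU.
by case: (pb_mul b c) => [d|] /=; rewrite ?gval_bas ?gval0.
Qed.
Lemma galg1 : 1 = \sum_(e <- pb_unit B) gbas K e.
Proof.
by apply: gvalK; rewrite gval1 gval_sum; apply: eq_bigr => e _; rewrite gval_bas.
Qed.
Lemma gr_gbas b : gr (pb_deg b) (gbas K b).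
Proof. by rewrite -[gr _ _]/(galg_gr _ _) galg_grE gval_bas; exact: bgr_bas. Qed.
Lemma galg_sumE x : x = \sum_(b <- supp x) kin (coef b x) * gbas K b.
Proof.
apply: gvalK; rewrite gval_sum {1}(balgE (gval x)) suppE; apply: eq_bigr => b _.
by rewrite gval_kinE gval_bas coefE.
Qed.

Lemma galg_ind (P : A -> Prop) :
  P 0 -> (forall x y, P x -> P y -> P (x + y)) ->
  (forall k b, P (kin k * gbas K b)) -> forall x, P x.
Proof. by move=> P0 PD PZ x; rewrite (galg_sumE x); apply: big_ind. Qed.

End BasisAlgebraStructure.

HB.lock Definition bext (K : fieldType) (B B' : pbasis) (h : B -> galg K B')
    (x : galg K B) : galg K B' := \sum_(b <- supp x) kin (coef b x) * h b.

Section Extension.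
Variables (K : fieldType) (B B' : pbasis) (h : B -> galg K B').
Implicit Types x y : galg K B.

Lemma gval_bext x : gval (bext h x) = lext (fun b => gval (h b)) (gval x).
Proof.
rewrite unlock gval_sum /lext suppE; apply: eq_bigr => b _.
by rewrite gval_kinE coefE.
Qed.
Lemma bextD x y : bext h (x + y) = bext h x + bext h y.
Proof. by apply: gvalK; rewrite !(gvalD, gval_bext) linearD. Qed.
Lemma bext0 : bext h 0 = 0.
Proof. by apply: gvalK; rewrite !(gval0, gval_bext) linear0. Qed.
Lemma bextB x y : bext h (x - y) = bext h x - bext h y.
Proof. by apply: gvalK; rewrite !(gvalB, gval_bext) linearB. Qed.
Lemma bextZ k x : bext h (kin k * x) = kin k * bext h x.
Proof. by apply: gvalK; rewrite !(gval_kinE, gval_bext) linearZ. Qed.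
Lemma bextU b : bext h (gbas K b) = h b.
Proof. by apply: gvalK; rewrite gval_bext gval_bas lextU. Qed.
Lemma bext_sum (J : Type) (s : seq J) (P : pred J) (F : J -> galg K B) :
  bext h (\sum_(j <- s | P j) F j) = \sum_(j <- s | P j) bext h (F j).
Proof. exact: (big_morph _ bextD bext0). Qed.
End Extension.

Section Paths.
Variable G : digraph.
Implicit Types (p q r : gpath G) (x y z : G).

Lemma pcat_some p q r : pcat p q = Some r ->
  pend p = pstart q /\ pval r = (pstart p, (pval p).2 ++ (pval q).2).
Proof.
rewrite /pcat; case: eqP => // E; case: insubP => //= u _ Hu [<-].
by split.
Qed.

Lemma pcat_def p q : pend p = pstart q -> exists r, pcat p q = Some r.
Proof.
move=> E; rewrite /pcat E eqxx; case: insubP => [r _ _|/=]; first by exists r.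
rewrite cat_path; have := pvalP p; have := pvalP q.
by rewrite /pstart /= in E *; rewrite -/(pend p) E => -> ->.
Qed.

Lemma pcat_none p q : pend p <> pstart q -> pcat p q = None.
Proof. by rewrite /pcat; case: eqP. Qed.

Lemma pcat_start p q r : pcat p q = Some r -> pstart r = pstart p.
Proof. by case/pcat_some => _ E; rewrite {1}/pstart E. Qed.
Lemma pcat_end p q r : pcat p q = Some r -> pend r = pend q.
Proof.
case/pcat_some => E F; rewrite /pend F /= last_cat.
by rewrite /pend in E; rewrite E.
Qed.
Lemma pcat_len p q r : pcat p q = Some r -> plen r = (plen p + plen q)%N.
Proof. by case/pcat_some => _ E; rewrite /plen E size_cat. Qed.

Lemma pcatA p q r :
  obind (fun u => pcat u r) (pcat p q) = obind (pcat p) (pcat q r).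
Proof.
case: (pselect (pend p = pstart q)) => [Epq|Npq]; last first.
  rewrite (pcat_none Npq) /=; case E: (pcat q r) => [u|] //=.
  by rewrite pcat_none // (pcat_start E).
have [u Eu] := pcat_def Epq; rewrite Eu /=.
case: (pselect (pend q = pstart r)) => [Eqr|Nqr]; last first.
  by rewrite (pcat_none Nqr) /= pcat_none // (pcat_end Eu).
have [v Ev] := pcat_def Eqr; rewrite Ev /=.
have [s Es] : exists s, pcat u r = Some s by apply: pcat_def; rewrite (pcat_end Eu).
have [t Et] : exists t, pcat p v = Some t by apply: pcat_def; rewrite (pcat_start Ev).
rewrite Es Et; congr Some; apply: val_inj => /=.
have [_ ->] := pcat_some Es; have [_ ->] := pcat_some Et.
rewrite (pcat_start Eu); have [_ ->] := pcat_some Eu; have [_ ->] := pcat_some Ev.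
by rewrite /= catA.
Qed.

Definition ptriv x : gpath G := @GPath G (x, [::]) isT.

Lemma ptriv_inj : injective ptriv. Proof. by move=> x y []. Qed.

Definition ptrivs : seq (gpath G) := [seq ptriv x | x <- enum G].

Lemma pcat1p e p : e \in ptrivs ->
  pcat e p = if e == ptriv (pstart p) then Some p else None.
Proof.
case/mapP => x _ ->; rewrite (inj_eq ptriv_inj) /pcat /=.
case: eqP => // E; rewrite /pstart /= in E *.
have -> : (x, (pval p).2) = pval p by rewrite [x]E; case: (pval p).
by rewrite valK.
Qed.

Lemma pcatp1 e p : e \in ptrivs ->
  pcat p e = if e == ptriv (pend p) then Some p else None.
Proof.
case/mapP => x _ ->; rewrite (inj_eq ptriv_inj) /pcat /= eq_sym.
case: eqP => // E; rewrite cats0 /pstart.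
have -> : ((pval p).1, (pval p).2) = pval p by case: (pval p).
by rewrite valK.
Qed.

Definition path_basis : pbasis.
Proof.
apply: (@PBasis (gpath G) (@pcat G) (@plen G) ptrivs (fun p => ptriv (pstart p))
  (fun p => ptriv (pend p))).
- exact: pcatA.
- by rewrite map_inj_uniq ?enum_uniq //; exact: ptriv_inj.
- by move=> p; rewrite map_f // mem_enum.
- by move=> p; rewrite map_f // mem_enum.
- by move=> e p; exact: pcat1p.
- by move=> e p; exact: pcatp1.
- by move=> p q r; exact: pcat_len.
- by move=> e /mapP [x _ ->].
Defined.

Lemma has_pathP x y n :
  reflect (exists p, [/\ pstart p = x, pend p = y & plen p = n]) (has_path x y n).
Proof. exact: asboolP. Qed.

Lemma dist_someP x y d :
  dist x y = Some d <-> has_path x y d /\ forall n, has_path x y n -> (d <= n)%N.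
Proof.
rewrite /dist; case: pselect => [H|H]; last first.
  by split => // -[Hd _]; case: H; exists d.
case: ex_minnP => m Hm Hmin; split; first by case=> <-.
by move=> [Hd Hd']; congr Some; apply/eqP; rewrite eqn_leq Hmin // Hd'.
Qed.

Lemma dist_le x y n : has_path x y n -> exists2 d, (d <= n)%N & dist x y = Some d.
Proof.
move=> Hn; rewrite /dist; case: pselect => [H|[]]; last by exists n.
by case: ex_minnP => m _ /(_ n Hn) Hm; exists m.
Qed.

Lemma dist_plen p : exists2 d, (d <= plen p)%N & dist (pstart p) (pend p) = Some d.
Proof. by apply: dist_le; apply/has_pathP; exists p. Qed.

Lemma dist_path x y d : dist x y = Some d ->
  exists p, [/\ pstart p = x, pend p = y, plen p = d & shortest p].
Proof.
move=> E; have [/has_pathP [p [H1 H2 H3]] _] := (dist_someP x y d).1 E.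
by exists p; split=> //; rewrite /shortest H1 H2 H3 E.
Qed.

Lemma dist_tri x y z a b : dist x y = Some a -> dist y z = Some b ->
  exists2 c, (c <= a + b)%N & dist x z = Some c.
Proof.
move=> /dist_path [p [H1 H2 H3 _]] /dist_path [q [K1 K2 K3 _]].
have [r Er] : exists r, pcat p q = Some r by apply: pcat_def; rewrite H2 K1.
apply: dist_le; apply/has_pathP; exists r.
by rewrite (pcat_start Er) (pcat_end Er) (pcat_len Er) H1 K2 H3 K3.
Qed.

Lemma distxx x : dist x x = Some 0%N.
Proof. by apply/dist_someP; split=> //; apply/has_pathP; exists (ptriv x). Qed.

Lemma dist0 x y : dist x y = Some 0%N -> x = y.
Proof.
by move=> /dist_path [p [<- <- + _]]; rewrite /plen /pend /pstart => /size0nil ->.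
Qed.

Lemma arrow_neq x y : arrow x y -> x != y.
Proof. by apply: contraTneq => ->; rewrite arrow_irr. Qed.

Lemma plen1 p : plen p = 1%N -> pval p = (pstart p, [:: pend p]) /\ pstart p != pend p.
Proof.
rewrite /pstart /pend; case: p => [[x s] /= Hp]; rewrite /plen /=.
case: s Hp => [|y [|]] //= /andP [Hxy _] _; split=> //; exact: arrow_neq.
Qed.

Lemma plen0 p : plen p = 0%N -> pval p = (pstart p, [::]).
Proof.
by rewrite /pstart; case: p => [[x s] /= Hp]; rewrite /plen /= => /size0nil ->.
Qed.

Lemma shortest_low p : (plen p <= 1)%N -> shortest p.
Proof.
have [d Hd E] := dist_plen p; rewrite /shortest E => Hp.
suff : d <> 0%N \/ plen p = 0%N by move: d (plen p) Hd Hp {E} => [|[|?]] [|[|?]] //= _ _ [].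
case: (posnP (plen p)) => [|Hp0]; [by right|left => d0].
have [_ /eqP []] : pval p = (pstart p, [:: pend p]) /\ pstart p != pend p.
  by apply: plen1; apply/eqP; rewrite eqn_leq Hp.
by apply: dist0; rewrite E d0.
Qed.

Lemma low_unique p q : (plen p <= 1)%N -> plen q = plen p -> connect_same p q -> p = q.
Proof.
move=> Hp Hq [E1 E2]; apply: val_inj => /=.
case: (posnP (plen p)) => Hp0; first by rewrite (plen0 Hp0) plen0 ?Hq // E1.
have H1 : plen p = 1%N by apply/eqP; rewrite eqn_leq Hp.
have [-> _] := plen1 H1; have [|-> _] := @plen1 q; first by rewrite Hq.
by rewrite E1 E2.
Qed.

Lemma shortest_cat p q r : pcat p q = Some r -> shortest r -> shortest p /\ shortest q.
Proof.
move=> Er; rewrite /shortest (pcat_start Er) (pcat_end Er) (pcat_len Er).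
have [a Ha Ea] := dist_plen p; have [b Hb Eb] := dist_plen q.
have [Epq _] := pcat_some Er; rewrite -Epq in Eb *.
have [c Hc Ec] := dist_tri Ea Eb.
rewrite Ec Ea Eb => /eqP [cE]; rewrite cE in Hc.
have ha : a = plen p.
  apply/eqP; rewrite eqn_leq Ha -(leq_add2r (plen q)).
  by apply: leq_trans Hc _; rewrite leq_add2l.
by split; [rewrite ha|move: Hc; rewrite ha leq_add2l => h; rewrite (@anti_leq b (plen q)) // Hb].
Qed.

Record dpair := DPair { dval : G * G; dvalP : dist dval.1 dval.2 != None }.
HB.instance Definition _ := [isSub for dval].
HB.instance Definition _ := [Choice of dpair by <:].

Definition dmul (a b : dpair) : option dpair :=
  if ((dval a).2 == (dval b).1) &&
     (dadd (dist (dval a).1 (dval a).2) (dist (dval b).1 (dval b).2) ==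
        dist (dval a).1 (dval b).2)
  then (insub ((dval a).1, (dval b).2) : option dpair) else None.

Definition ddeg (a : dpair) : nat := odflt 0%N (dist (dval a).1 (dval a).2).

Lemma ddegE a : dist (dval a).1 (dval a).2 = Some (ddeg a).
Proof. by rewrite /ddeg; case: (dist _ _) (valP a). Qed.

Lemma dmulP a b c : dmul a b = Some c <->
  [/\ (dval a).2 = (dval b).1, dval c = ((dval a).1, (dval b).2) & ddeg c = (ddeg a + ddeg b)%N].
Proof.
rewrite /dmul !ddegE; split.
  case: andP => // -[/eqP H1 /eqP /= H2].
  case: insubP => // u _ Hu [<-]; split=> //.
  by rewrite {1}/ddeg Hu /= -H2.
move=> [H1 H2 H3]; rewrite H1 eqxx /=.
have E : dist (dval a).1 (dval b).2 = Some (ddeg a + ddeg b)%N.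
  by rewrite -H3 -ddegE H2.
by rewrite E eqxx -H2 valK.
Qed.

Lemma dpair_tri (a b : dpair) : (dval a).2 = (dval b).1 ->
  exists2 c : dpair, dval c = ((dval a).1, (dval b).2) & (ddeg c <= ddeg a + ddeg b)%N.
Proof.
move=> E; have Ha := ddegE a; have Hb := ddegE b; rewrite -E in Hb.
have [c Hc Ec] := dist_tri Ha Hb.
have cP : dist ((dval a).1, (dval b).2).1 ((dval a).1, (dval b).2).2 != None by rewrite Ec.
by exists (DPair cP); rewrite // /ddeg /= Ec.
Qed.

Lemma opt_eq (T : Type) (o o' : option T) : (forall t, o = Some t <-> o' = Some t) -> o = o'.
Proof.
case: o => [t|] H; first by rewrite (H t).1.
by case: o' H => // t H; have := (H t).2 erefl.
Qed.

Lemma obindP (T U : Type) (f : T -> option U) (o : option T) u :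
  obind f o = Some u <-> exists2 t, o = Some t & f t = Some u.
Proof. by case: o => [t|]; split=> //=; [exists t|case=> ? [<-]|case]. Qed.

Lemma dmulA a b c :
  obind (fun u => dmul u c) (dmul a b) = obind (dmul a) (dmul b c).
Proof.
apply: opt_eq => t; rewrite !obindP; split.
  move=> [u /dmulP [H1 H2 H3] /dmulP [K1 K2 K3]].
  rewrite H2 /= in K1 K2.
  have [v Hv Dv] := dpair_tri K1.
  have [w Hw Dw] : exists2 w : dpair, dval w = ((dval a).1, (dval v).2) & (ddeg w <= ddeg a + ddeg v)%N.
    by apply: dpair_tri; rewrite Hv H1.
  have wt : w = t by apply: val_inj; rewrite /= Hw K2 Hv.
  have Dv' : ddeg v = (ddeg b + ddeg c)%N.
    apply/eqP; rewrite eqn_leq Dv /= -(leq_add2l (ddeg a)) addnA -H3 -K3 -wt; exact: Dw.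
  exists v; first by apply/dmulP.
  by apply/dmulP; split; rewrite ?Hv ?H1 ?K2 // K3 H3 Dv' addnA.
move=> [u /dmulP [H1 H2 H3] /dmulP [K1 K2 K3]].
rewrite H2 /= in K1 K2.
have [v Hv Dv] := dpair_tri K1.
have [w Hw Dw] : exists2 w : dpair, dval w = ((dval v).1, (dval c).2) & (ddeg w <= ddeg v + ddeg c)%N.
  by apply: dpair_tri; rewrite Hv H1.
have wt : w = t by apply: val_inj; rewrite /= Hw K2 Hv.
have Dv' : ddeg v = (ddeg a + ddeg b)%N.
  apply/eqP; rewrite eqn_leq Dv /= -(leq_add2r (ddeg c)) -addnA -H3 -K3 -wt; exact: Dw.
exists v; first by apply/dmulP.
by apply/dmulP; split; rewrite ?Hv ?H1 ?K2 // K3 H3 Dv' addnA.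
Qed.

Lemma diagP x : dist (x, x).1 (x, x).2 != None. Proof. by rewrite distxx. Qed.
Definition diag x : dpair := DPair (diagP x).
Definition diags : seq dpair := [seq diag x | x <- enum G].

Lemma diag_inj : injective diag.
Proof. by move=> x y []. Qed.
Lemma ddeg_diag x : ddeg (diag x) = 0%N. Proof. by rewrite /ddeg /= distxx. Qed.

Lemma dmul1 e a : e \in diags ->
  dmul e a = if e == diag (dval a).1 then Some a else None.
Proof.
case/mapP => x _ ->; rewrite (inj_eq diag_inj); case: eqP => [->|N].
  by apply/dmulP; rewrite ddeg_diag /=; split=> //; case: (dval a).
by apply: opt_eq => t; split=> // /dmulP [].
Qed.

Lemma dmulr1 e a : e \in diags ->
  dmul a e = if e == diag (dval a).2 then Some a else None.
Proof.
case/mapP => x _ ->; rewrite (inj_eq diag_inj); case: eqP => [->|N].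
  by apply/dmulP; rewrite ddeg_diag addn0 /=; split=> //; case: (dval a).
by apply: opt_eq => t; split=> // /dmulP [] /= /esym.
Qed.

Definition dist_basis : pbasis.
Proof.
apply: (@PBasis dpair dmul ddeg diags (fun a => diag (dval a).1) (fun a => diag (dval a).2)).
- exact: dmulA.
- by rewrite map_inj_uniq ?enum_uniq //; exact: diag_inj.
- by move=> p; rewrite map_f // mem_enum.
- by move=> p; rewrite map_f // mem_enum.
- by move=> e p; exact: dmul1.
- by move=> e p; exact: dmulr1.
- by move=> p q r /dmulP [].
- by move=> e /mapP [x _ ->]; exact: ddeg_diag.
Defined.

End Paths.

Definition path_alg (K : fieldType) (G : digraph) : grAlgType K := galg K (path_basis G).
Definition sigma (K : fieldType) (G : digraph) : grAlgType K := galg K (dist_basis G).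

Section DistancePresentation.
Variables (K : fieldType) (G : digraph).
Local Notation KG := (path_alg K G).
Local Notation sG := (sigma K G).
Implicit Types (p q r : gpath G).

Definition pbas p : KG := gbas K (p : path_basis G).
Definition dbas (a : dpair G) : sG := gbas K (a : dist_basis G).

Definition sigma_rel (x : KG) : Prop :=
  (exists p q, [/\ shortest p, shortest q, connect_same p q & x = pbas p - pbas q]) \/
  (exists2 p, long p & x = pbas p).

Lemma gr_pbas p : gr (plen p) (pbas p).
Proof. exact: (@gr_gbas K (path_basis G)). Qed.

Lemma shortest_len p q : shortest p -> shortest q -> connect_same p q -> plen p = plen q.
Proof. by rewrite /shortest => /eqP H1 /eqP H2 [E1 E2]; move: H1; rewrite E1 E2 H2 => -[]. Qed.

Lemma sigma_rel_hom x : sigma_rel x -> exists n, gr n x.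
Proof.
case=> [[p [q [Hp Hq E ->]]]|[p _ ->]]; last by exists (plen p); exact: gr_pbas.
exists (plen p); apply: grB; first exact: gr_pbas.
by rewrite (shortest_len Hp Hq E); exact: gr_pbas.
Qed.

Definition sigma_ideal : hideal KG := gen_hideal sigma_rel_hom.

Lemma ends_dpair p : dist (pstart p, pend p).1 (pstart p, pend p).2 != None.
Proof. by have [d _ /= ->] := dist_plen p. Qed.
Definition ends p : dpair G := DPair (ends_dpair p).

Definition sproj0 p : sG := if shortest p then dbas (ends p) else 0.
Definition sproj (x : KG) : sG := bext (sproj0 : path_basis G -> galg K (dist_basis G)) x.

Lemma sprojD x y : sproj (x + y) = sproj x + sproj y. Proof. exact: bextD. Qed.
Lemma sprojB x y : sproj (x - y) = sproj x - sproj y. Proof. exact: bextB. Qed.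
Lemma sproj_0 : sproj 0 = 0. Proof. exact: bext0. Qed.
Lemma sprojZ k x : sproj (kin k * x) = kin k * sproj x. Proof. exact: bextZ. Qed.
Lemma sprojU p : sproj (pbas p) = sproj0 p. Proof. exact: bextU. Qed.
Lemma sproj_sum (J : Type) (s : seq J) (P : pred J) (F : J -> KG) :
  sproj (\sum_(j <- s | P j) F j) = \sum_(j <- s | P j) sproj (F j).
Proof. exact: bext_sum. Qed.

Lemma KG_ind (P : KG -> Prop) :
  P 0 -> (forall x y, P x -> P y -> P (x + y)) ->
  (forall k p, P (kin k * pbas p)) -> forall x, P x.
Proof. exact: (@galg_ind K (path_basis G)). Qed.
Lemma sG_ind (P : sG -> Prop) :
  P 0 -> (forall x y, P x -> P y -> P (x + y)) ->
  (forall k a, P (kin k * dbas a)) -> forall x, P x.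
Proof. exact: (@galg_ind K (dist_basis G)). Qed.
Lemma KG_sumE (x : KG) :
  x = \sum_(p <- @supp K (path_basis G) x) kin (@coef K (path_basis G) p x) * pbas p.
Proof. exact: (@galg_sumE K (path_basis G)). Qed.
Lemma sG_sumE (y : sG) :
  y = \sum_(a <- @supp K (dist_basis G) y) kin (@coef K (dist_basis G) a y) * dbas a.
Proof. exact: (@galg_sumE K (dist_basis G)). Qed.
Lemma gr_dbas a : gr (ddeg a) (dbas a).
Proof. exact: (@gr_gbas K (dist_basis G)). Qed.
Lemma pbasM p q : pbas p * pbas q = if pcat p q is Some r then pbas r else 0.
Proof. exact: (@gbasM K (path_basis G)). Qed.
Lemma dbasM a b : dbas a * dbas b = if dmul a b is Some c then dbas c else 0.
Proof. exact: (@gbasM K (dist_basis G)). Qed.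

Lemma ddeg_ends p : shortest p -> ddeg (ends p) = plen p.
Proof. by rewrite /shortest /ddeg /= => /eqP ->. Qed.

Lemma sproj0M p q : sproj (pbas p * pbas q) = sproj0 p * sproj0 q.
Proof.
rewrite pbasM.
case Epq: (pcat p q) => [r|] /=; last first.
  rewrite sproj_0 /sproj0; case: ifP => _; last by rewrite mul0r.
  case: ifP => _; last by rewrite mulr0.
  rewrite dbasM; case E: (dmul _ _) => [c|] //=.
  have [/= /pcat_def [r Hr] _ _] := (dmulP _ _ _).1 E.
  by rewrite Epq in Hr.
rewrite sprojU /sproj0.
have [Ee _] := pcat_some Epq.
case: (boolP (shortest r)) => Hr.
  have [Hp Hq] := shortest_cat Epq Hr; rewrite Hp Hq dbasM.
  suff -> : dmul (ends p) (ends q) = Some (ends r) by [].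
  apply/dmulP; rewrite !ddeg_ends // (pcat_len Epq); split=> //=.
  by rewrite (pcat_start Epq) (pcat_end Epq).
case: ifP => Hp; last by rewrite mul0r.
case: ifP => Hq; last by rewrite mulr0.
rewrite dbasM; case E: (dmul _ _) => [c|] //=.
have [_ Ec Dc] := (dmulP _ _ _).1 E.
case/negP: Hr; rewrite /shortest (pcat_len Epq) (pcat_start Epq) (pcat_end Epq).
by have := ddegE c; rewrite Ec Dc /= !ddeg_ends // => ->.
Qed.

Lemma kin_swap (A : grAlgType K) k (x y : A) : x * (kin k * y) = kin k * (x * y).
Proof. by rewrite mulrA -kinC mulrA. Qed.

Lemma sprojM x y : sproj (x * y) = sproj x * sproj y.
Proof.
elim/KG_ind: x => [|x x' Hx Hx'|k p]; first by rewrite mul0r sproj_0 mul0r.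
  by rewrite mulrDl !sprojD Hx Hx' mulrDl.
rewrite -mulrA !sprojZ -mulrA; congr (_ * _).
elim/KG_ind: y => [|y y' Hy Hy'|l q]; first by rewrite mulr0 sproj_0 mulr0.
  by rewrite mulrDr !sprojD Hy Hy' mulrDr.
by rewrite kin_swap !sprojZ kin_swap sproj0M !sprojU.
Qed.

Lemma sproj1 : sproj 1 = 1.
Proof.
rewrite /sproj (galg1 K (path_basis G)) (galg1 K (dist_basis G)) bext_sum /=.
rewrite /ptrivs /diags !big_map; apply: eq_bigr => x _.
rewrite -[gbas K _]/(pbas (ptriv x)) -/(sproj _) sprojU /sproj0 shortest_low //.
by congr dbas; apply: val_inj.
Qed.

Lemma sproj_kin k : sproj (kin k) = kin k.
Proof. by rewrite -[in LHS](mulr1 (kin k)) sprojZ sproj1 mulr1. Qed.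

Lemma gr_kinM (A : grAlgType K) n k (x : A) : gr n x -> gr n (kin k * x).
Proof. by move=> Hx; rewrite -(add0n n); apply: grM => //; exact: gr_kin. Qed.

Lemma sproj_gr n x : gr n x -> gr n (sproj x).
Proof.
move=> Hx; rewrite [x]KG_sumE sproj_sum big_seq.
apply: gr_sum => p /((grP n x).1 Hx) Hp; rewrite sprojZ; apply: gr_kinM.
rewrite sprojU /sproj0; case: ifP => H; last exact: gr_sub0.
by rewrite -Hp -[pb_deg p]/(plen p) -(ddeg_ends H); exact: gr_dbas.
Qed.

Lemma sigma_ideal_ker x : sigma_ideal x -> sproj x = 0.
Proof.
move=> /(_ (fun x => sproj x = 0)); apply.
  split=> [|y z Hy Hz|a y b Hy]; first exact: sproj_0.
    by rewrite sprojD Hy Hz addr0.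
  by rewrite !sprojM Hy mulr0 mul0r.
move=> y [[p [q [Hp Hq [E1 E2] ->]]]|[p Hp ->]]; last first.
  by rewrite sprojU /sproj0 (negbTE Hp).
rewrite sprojB !sprojU /sproj0 Hp Hq.
suff -> : ends p = ends q by rewrite subrr.
by apply: val_inj; rewrite /= E1 E2.
Qed.

Lemma lift_path (a : dpair G) :
  {p | [/\ pstart p = (dval a).1, pend p = (dval a).2 & shortest p]}.
Proof.
apply: cid; have [p [H1 H2 _ H4]] := dist_path (ddegE a).
by exists p.
Qed.
Definition slift0 (a : dpair G) : KG := pbas (sval (lift_path a)).
Definition slift (y : sG) : KG := bext (slift0 : dist_basis G -> galg K (path_basis G)) y.

Lemma slift_ends p : shortest p ->
  shortest (sval (lift_path (ends p))) /\ connect_same (sval (lift_path (ends p))) p.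
Proof. by move=> _; case: (lift_path _) => q /= [H1 H2 H3]; split. Qed.

Lemma sliftD x y : slift (x + y) = slift x + slift y. Proof. exact: bextD. Qed.
Lemma slift_0 : slift 0 = 0. Proof. exact: bext0. Qed.
Lemma sliftZ k x : slift (kin k * x) = kin k * slift x. Proof. exact: bextZ. Qed.
Lemma sliftU a : slift (dbas a) = slift0 a. Proof. exact: bextU. Qed.
Lemma slift_sum (J : Type) (s : seq J) (P : pred J) (F : J -> sG) :
  slift (\sum_(j <- s | P j) F j) = \sum_(j <- s | P j) slift (F j).
Proof. exact: bext_sum. Qed.

Lemma slift_gr n y : gr n y -> gr n (slift y).
Proof.
move=> Hy; rewrite [y]sG_sumE slift_sum big_seq.
apply: gr_sum => a /((grP n y).1 Hy) Ha; rewrite sliftZ; apply: gr_kinM.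
rewrite sliftU -Ha /slift0.
case: (lift_path a) => p [H1 H2 H3] /=.
suff <- : plen p = ddeg a by exact: gr_pbas.
by move: H3; rewrite /shortest H1 H2 ddegE => /eqP [].
Qed.

Lemma sproj_slift y : sproj (slift y) = y.
Proof.
elim/sG_ind: y => [|y y' Hy Hy'|k a]; first by rewrite slift_0 sproj_0.
  by rewrite sliftD sprojD Hy Hy'.
rewrite sliftZ sprojZ; congr (_ * _); rewrite sliftU sprojU /sproj0.
case: (lift_path a) => p [H1 H2 H3] /=; rewrite H3.
by congr dbas; apply: val_inj; rewrite /= H1 H2; case: (dval a).
Qed.

Lemma sigma_idealP x : sigma_ideal (slift (sproj x) - x).
Proof.
have [I0 ID _] := hidealP sigma_ideal.
elim/KG_ind: x => [|x x' Hx Hx'|k p].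
- by rewrite sproj_0 slift_0 subr0.
- by rewrite sprojD sliftD opprD addrACA; apply: ID.
rewrite sprojZ sliftZ -mulrBr; apply: (idealMl _ (hidealP sigma_ideal)).
rewrite sprojU /sproj0; case: ifP => H.
  rewrite sliftU; apply: ideal_gen_sub; left.
  have [H1 H2] := slift_ends H.
  by exists (sval (lift_path (ends p))), p; split.
rewrite slift_0 sub0r; apply: (idealN (hidealP sigma_ideal)); apply: ideal_gen_sub; right.
by exists p => //; rewrite H.
Qed.

Lemma sigma_kernel x : sigma_ideal x <-> sproj x = 0.
Proof.
split; first exact: sigma_ideal_ker.
move=> E; have := idealN (hidealP sigma_ideal) (sigma_idealP x).
by rewrite E slift_0 sub0r opprK.
Qed.

Lemma sigma_low n x : (n <= 1)%N -> gr n x -> sigma_ideal x -> x = 0.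
Proof.
move=> Hn Hx /sigma_ideal_ker E.
have : slift (sproj x) = 0 by rewrite E slift_0.
suff -> : slift (sproj x) = x by [].
rewrite [in RHS](KG_sumE x) {1}(KG_sumE x).
rewrite sproj_sum slift_sum big_seq [RHS]big_seq.
apply: eq_bigr => p /((grP n x).1 Hx) Hp; rewrite sprojZ sliftZ; congr (_ * _).
have Lp : (plen p <= 1)%N by rewrite -[plen p]/(pb_deg (p : path_basis G)) Hp.
have Sp := shortest_low Lp.
rewrite sprojU /sproj0 Sp sliftU /slift0.
have [H1 H2] := slift_ends Sp; have E1 := shortest_len H1 Sp H2.
by congr pbas; apply: low_unique; rewrite ?E1.
Qed.

Definition sigma_map (u : quotalg sigma_ideal) : sG := sproj (repr u).

Lemma sigma_map_pi x : sigma_map (qpi sigma_ideal x) = sproj x.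
Proof.
apply/eqP; rewrite -subr_eq0 -sprojB; apply/eqP/sigma_ideal_ker/qpi_eq.
by rewrite qpi_repr.
Qed.

Lemma sigma_mapB : zmod_morphism sigma_map.
Proof.
move=> u v; rewrite -(qpi_repr u) -(qpi_repr v) -qpiB !sigma_map_pi.
exact: sprojB.
Qed.
Lemma sigma_mapM : monoid_morphism sigma_map.
Proof.
split; first by rewrite -qpi1 sigma_map_pi sproj1.
move=> u v; rewrite -(qpi_repr u) -(qpi_repr v) -qpi_rM !sigma_map_pi.
exact: sprojM.
Qed.
HB.instance Definition _ := GRing.isZmodMorphism.Build (quotalg sigma_ideal) sG
  sigma_map sigma_mapB.
HB.instance Definition _ := GRing.isMonoidMorphism.Build (quotalg sigma_ideal) sG
  sigma_map sigma_mapM.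

Lemma sigma_iso : gr_iso (quotalg sigma_ideal) sG.
Proof.
have E (u : quotalg sigma_ideal) : qpi sigma_ideal (slift (sigma_map u)) = u.
  rewrite -[RHS]qpi_repr; apply/qpi_eq; exact: sigma_idealP.
exists sigma_map; split.
- by move=> k; rewrite -sproj_kin; exact: sigma_map_pi.
- exists (fun y => qpi sigma_ideal (slift y)) => [u|y]; first exact: E.
  by rewrite -[RHS]sproj_slift; exact: sigma_map_pi.
move=> n u; split; first by case=> x Hx <-; rewrite [X in gr n X]sigma_map_pi; exact: sproj_gr.
by move=> H; exists (slift (sigma_map u)); [exact: slift_gr|exact: E].
Qed.

End DistancePresentation.

(* A graded isomorphism A = KG/I with I homogeneous and I_0 = I_1 = 0. Both the
   property of being quadratic and the quadratic dual refer to such data. *)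
Record presentation (K : fieldType) (G : digraph) (A : grAlgType K) := Presentation {
  pres_ideal : hideal (path_alg K G);
  pres_low : forall n x, (n <= 1)%N -> gr n x -> pres_ideal x -> x = 0;
  pres_iso : gr_iso (quotalg pres_ideal) A
}.

Definition sigma_pres (K : fieldType) (G : digraph) : presentation G (sigma K G) :=
  Presentation (@sigma_low K G) (@sigma_iso K G).

Section QuadraticDual.
Variables (K : fieldType) (G : digraph) (A : grAlgType K) (P : presentation G A).

Definition quadratic : Prop :=
  forall x, pres_ideal P x <-> ideal_gen (fun y => gr 2 y /\ pres_ideal P y) x.

Lemma oppath_subproof (p : gpath G) :
  path (@arrow (opdigraph G)) (pend p) (rev (belast (pval p).1 (pval p).2)).
Proof. by rewrite /pend rev_path; exact: pvalP. Qed.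

Definition oppath (p : gpath G) : gpath (opdigraph G) :=
  @GPath (opdigraph G) (pend p, rev (belast (pval p).1 (pval p).2)) (oppath_subproof p).

(* The bilinear form with <p, q> = 1 if q = oppath p, and 0 otherwise. *)
Definition pairing (x : path_alg K G) (y : path_alg K (opdigraph G)) : K :=
  \sum_(p <- @supp K (path_basis G) x)
    @coef K (path_basis G) p x * @coef K (path_basis (opdigraph G)) (oppath p) y.

Definition orthogonal2 (y : path_alg K (opdigraph G)) : Prop :=
  gr 2 y /\ forall x, gr 2 x -> pres_ideal P x -> pairing x y = 0.

Lemma orthogonal2_hom y : orthogonal2 y -> exists n, gr n y.
Proof. by case=> Hy _; exists 2. Qed.

Definition qdual : grAlgType K := quotalg (gen_hideal orthogonal2_hom).

End QuadraticDual.

Section PathCochains.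
Variables (K : fieldType) (G : digraph).

(* The tuple (x, v, y) as an element of KG, zero if it is not a path. *)
Definition tuple3 (x v y : G) : path_alg K G :=
  if insub (x, [:: v; y]) is Some p then pbas K (p : gpath G) else 0.

Definition omega_rel (t : path_alg K G) : Prop :=
  exists x y : G, dist x y = Some 2%N /\ t = \sum_(v : G) tuple3 x v y.

Lemma omega_rel_hom t : omega_rel t -> exists n, gr n t.
Proof.
case=> x [y [_ ->]]; exists 2; apply: gr_sum => v _; rewrite /tuple3.
case: insubP => [p _ E|_]; last exact: gr_sub0.
by have := gr_pbas K p; rewrite (_ : plen p = 2%N) // /plen [pval p]E.
Qed.

Definition Omega : grAlgType K := quotalg (gen_hideal omega_rel_hom).

End PathCochains.

(* Main.v *)
From HB Require Import structures.
Require Import Defs.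
From mathcomp Require Import all_boot all_algebra.
From mathcomp Require Import boolp.
From mathcomp.multinomials Require Import monalg.
Set Implicit Arguments. Unset Strict Implicit. Unset Printing Implicit Defensive.
Import GRing.Theory.
Local Open Scope ring_scope.

(** Everything is governed by the classes of the 2-short congruence that contain no
    2-reducible path. Call a path quasi-reducible if its class contains one.

    Quadraticity. Modulo the ideal generated by the degree 2 relations of sigma G,
    congruent paths become equal and quasi-reducible paths become zero, and nothing
    else happens: each remaining class c carries a linear functional, the sum of
    the coefficients over c, which kills that ideal (class_part_ideal). The full
    ideal of relations identifies all shortest paths with the same ends and kills
    all long paths. So the two ideals agree exactly when (V_2) holds
    (V2_quadratic, quadratic_V2); a single field suffices for the converse.

    Magnitude homology. A path of length l, cut at an inner vertex, gives a triple
    (start, vertex, end), which is a generator of degree 2 and norm l when both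
    pieces are shortest and is read as zero otherwise. Modulo boundaries the triple
    does not depend on the inner vertex (cut_move). When l is at least 3 there are
    at least two inner vertices, so replacing a subpath of length 2 leaves one of
    them in place: the triple depends only on the congruence class of the path
    (path_chain_two_short), and it is zero for quasi-reducible paths. Under (V_2) the
    triples with ends at distance less than l are therefore boundaries, and those
    with ends at distance l depend only on their ends, so a cycle is a boundary
    (V2_boundary).

    Conversely, argue by induction on l. If (V_2) holds for paths shorter than l,
    composing shortest paths through y attaches to a triple (x, y, z) a well-defined
    class of paths of length l. Counting the triples attached to a class that is
    not quasi-reducible gives a functional that vanishes on boundaries
    (class_count_boundary), and evaluating it on triples of paths of length l gives
    (V_2) in length l (V2_step).

    Quadratic dual. The degree 2 relations are spanned by differences of shortest
    paths and by long paths, so their orthogonal complement is spanned by the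
    elements t_(x,y) of the opposite digraph. Hence the ideals defining the dual of
    sigma G and Omega of the opposite digraph are the same (qdual_Omega). *)

(** * Moves and quasi-reducible paths *)

Section PathCongruence.
Variable G : digraph.
Implicit Types (p q r u v a b : gpath G) (x y z : G).

Definition pcat3 a p b : option (gpath G) :=
  obind (fun u => pcat u b) (pcat a p).

Lemma pcat3P a p b r :
  pcat3 a p b = Some r <-> exists2 ap, pcat a p = Some ap & pcat ap b = Some r.
Proof. by rewrite /pcat3 obindP. Qed.

Lemma pcat3Pr a p b r :
  pcat3 a p b = Some r <-> exists2 pb, pcat p b = Some pb & pcat a pb = Some r.
Proof. by rewrite /pcat3 pcatA obindP. Qed.

Lemma pcat_ptriv p q : pcat p (ptriv (pend p)) = Some p /\ pcat (ptriv (pstart q)) q = Some q.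
Proof. by rewrite pcatp1 ?pcat1p ?map_f ?mem_enum // !eqxx. Qed.

Lemma pcat3_triv p : pcat3 (ptriv (pstart p)) p (ptriv (pend p)) = Some p.
Proof.
by have [H1 H2] := pcat_ptriv p p; apply/pcat3P; exists p.
Qed.

Lemma pcat3_ends a p b p' r : connect_same p p' -> pcat3 a p b = Some r ->
  exists r', pcat3 a p' b = Some r'.
Proof.
move=> [E1 E2] /pcat3P[ap Hap Hr].
have [Ea _] := pcat_some Hap; have [Eb _] := pcat_some Hr.
have [ap' Hap'] : exists s, pcat a p' = Some s by apply: pcat_def; rewrite Ea.
have [r' Hr'] : exists s, pcat ap' b = Some s.
  by apply: pcat_def; rewrite (pcat_end Hap') -E2 -(pcat_end Hap).
by exists r'; apply/pcat3P; exists ap'.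
Qed.

Lemma pcat3_comp a' b' a p b r s : pcat3 a p b = Some r -> pcat3 a' r b' = Some s ->
  exists c d, pcat a' a = Some c /\ pcat b b' = Some d /\ pcat3 c p d = Some s.
Proof.
move=> /pcat3P[ap H1 H2] /pcat3P[ar H3 H4].
have /pcat3Pr[pb K1 K2] : pcat3 a p b = Some r by apply/pcat3P; exists ap.
have [c Hc] : exists s, pcat a' a = Some s.
  by apply: pcat_def; rewrite -(pcat_start K2); case: (pcat_some H3).
have [d Hd] : exists s, pcat b b' = Some s.
  apply: pcat_def; rewrite -(pcat_end H2) -(pcat_end H3); by case: (pcat_some H4).
exists c, d; split=> //; split=> //.
have : pcat3 a' ap b = Some ar by apply/pcat3Pr; exists r.
case/pcat3P=> t T1 T2.
have : pcat3 a' a p = Some t by apply/pcat3Pr; exists ap.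
rewrite /pcat3 Hc /= => T3; rewrite T3 /=.
have : pcat3 t b b' = Some s by apply/pcat3P; exists ar.
by rewrite /pcat3 pcatA Hd.
Qed.

(** Subpaths are given as infixes of vertex lists; every use below needs them as
    the middle factor of a concatenation, because congruences are stated there. *)
Lemma subpathP u p : subpath u p -> exists a b, pcat3 a u b = Some p.
Proof.
case/infixP => s1 [s2 E].
have P : path (@arrow G) (pval p).1 (pval p).2 by exact: pvalP.
have Pu : path (@arrow G) (pval u).1 (pval u).2 by exact: pvalP.
case: s1 E => [|x s1] /= [E1 E2].
  exists (ptriv (pstart u)).
  have Pb : path (@arrow G) (pend u) s2.
    by move: P; rewrite E1 E2 cat_path => /andP[].
  exists (@GPath G (pend u, s2) Pb).
  rewrite /pcat3 (pcat_ptriv u u).2 /=.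
  have [r Hr] : exists r, pcat u (@GPath G (pend u, s2) Pb) = Some r by exact: pcat_def.
  rewrite Hr; congr Some; apply: val_inj => /=.
  have [_ ->] := pcat_some Hr; rewrite /pstart -E1 /= -E2; by case: (pval p).
move: P; rewrite E1 E2 -cat_rcons cat_path last_rcons => /andP[Pa].
rewrite cat_path => /andP[_ Pb].
pose a := @GPath G (x, rcons s1 (pval u).1) Pa.
pose b := @GPath G (pend u, s2) Pb.
exists a, b.
have [au Hau] : exists r, pcat a u = Some r.
  by apply: pcat_def; rewrite /pend /= last_rcons.
rewrite /pcat3 Hau /=.
have [r Hr] : exists r, pcat au b = Some r by apply: pcat_def; rewrite (pcat_end Hau).
rewrite Hr; congr Some; apply: val_inj => /=.
have [_ ->] := pcat_some Hr; rewrite (pcat_start Hau); have [_ ->] := pcat_some Hau.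
by rewrite /= /pstart /= -catA cat_rcons -E1 -E2; case: (pval p).
Qed.

Lemma pcat3_subpath a u b p : pcat3 a u b = Some p -> subpath u p.
Proof.
case/pcat3P => au H1 H2; apply/infixP.
have [E _] := pcat_some H1.
have [_ P2] := pcat_some H2; have [_ P1] := pcat_some H1.
exists (belast (pval a).1 (pval a).2), (pval b).2.
rewrite /verts P2 (pcat_start H1) P1 /= -catA -cat_cons lastI.
by rewrite -/(pend a) E cat_rcons.
Qed.

Lemma shortest_sub a u b p : pcat3 a u b = Some p -> shortest p -> shortest u.
Proof. by move=> /pcat3P[au H1 H2] /(shortest_cat H2)[/(shortest_cat H1)[]]. Qed.

Lemma pcat3_len a u b p : pcat3 a u b = Some p -> plen p = (plen a + plen u + plen b)%N.
Proof. by move=> /pcat3P[au H1 H2]; rewrite (pcat_len H2) (pcat_len H1). Qed.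

Lemma long_len2 u : long u -> (plen u <= 2)%N -> plen u = 2%N.
Proof.
move=> Lu; rewrite leq_eqVlt => /orP[/eqP //|]; rewrite ltnS => H.
by rewrite shortest_low in Lu.
Qed.

(** The relation asking for S between all extensions a p b and a q b is a
    congruence as soon as S is an equivalence; by minimality it contains the
    2-short congruence. So S has only to be checked on single moves, which replace
    one shortest subpath of length exactly 2 by another: a path of length at most 1
    is determined by its ends. *)
Lemma two_short_ind (S : gpath G -> gpath G -> Prop) :
  (forall p, S p p) -> (forall p q, S p q -> S q p) ->
  (forall p q r, S p q -> S q r -> S p r) ->
  (forall a b u v p q, shortest u -> shortest v -> connect_same u v -> plen u = 2%N ->
     pcat3 a u b = Some p -> pcat3 a v b = Some q -> S p q) ->
  forall p q, two_short p q -> S p q.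
Proof.
move=> Sr Ss St Sg p q H.
pose R p q := connect_same p q /\
  forall a b r r', pcat3 a p b = Some r -> pcat3 a q b = Some r' -> S r r'.
have : R p q; last first.
  case=> [[E1 E2]]; apply; first exact: pcat3_triv.
  by rewrite E1 E2; exact: pcat3_triv.
apply: H; first split.
- by move=> r; split=> [//|a b s s' -> [->]].
- move=> r s [[E1 E2] H]; split=> [//|a b t t' T1 T2]; apply: Ss; exact: H T2 T1.
- move=> r s t [[E1 E2] H1] [[E3 E4] H2]; split.
    by split; [rewrite E1|rewrite E2].
  move=> a b w w' W1 W2.
  have [w0 W0] := @pcat3_ends a r b s w (conj E1 E2) W1.
  exact: St (H1 _ _ _ _ W1 W0) (H2 _ _ _ _ W0 W2).
- by move=> ? ? [].
- move=> a r r' b s s' [E H] K K'; split.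
    have /pcat3P[ar A1 A2] : pcat3 a r b = Some s := K.
    have /pcat3P[ar' A1' A2'] : pcat3 a r' b = Some s' := K'.
    split; first by rewrite (pcat_start A2) (pcat_start A1) (pcat_start A2') (pcat_start A1').
    by rewrite (pcat_end A2) (pcat_end A2').
  move=> a' b' t t' T T'.
  have [c [d [C1 [C2 C3]]]] := pcat3_comp K T.
  have [c' [d' [C1' [C2' C3']]]] := pcat3_comp K' T'.
  move: C1' C2' C3'; rewrite C1 C2 => -[<-] [<-] C3'.
  exact: H C3 C3'.
move=> u v Hu Hv E; rewrite leq_eqVlt => /orP[/eqP|] Lu; split=> // a b r r' K K'.
  exact: Sg K K'.
rewrite ltnS in Lu.
have Euv : u = v by apply: low_unique => //; exact/esym/shortest_len.
by move: K'; rewrite -Euv K => -[->].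
Qed.

Lemma two_short_refl p : two_short p p.
Proof. by move=> R HR _; exact: congr_refl. Qed.
Lemma two_short_sym p q : two_short p q -> two_short q p.
Proof. by move=> H R HR HS; apply: (congr_sym HR); exact: H. Qed.
Lemma two_short_trans q p r : two_short p q -> two_short q r -> two_short p r.
Proof. by move=> H1 H2 R HR HS; apply: (congr_trans HR); [exact: H1|exact: H2]. Qed.
Lemma two_short_ends p q : two_short p q -> connect_same p q.
Proof.
apply: two_short_ind => [//|? ? []|? ? ? [E1 E2] [E3 E4]|]; rewrite /connect_same.
- by split.
- by rewrite E1 E2.
move=> a b u v r s _ _ E _ /pcat3P[au A1 A2] /pcat3P[av B1 B2]; split.
  by rewrite (pcat_start A2) (pcat_start B2) (pcat_start A1) (pcat_start B1).
by rewrite (pcat_end A2) (pcat_end B2).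
Qed.
Lemma two_short_len p q : two_short p q -> plen p = plen q.
Proof.
apply: (@two_short_ind (fun p q => plen p = plen q)) => [//|//|? ? ? -> -> //|].
move=> a b u v r s Hu Hv E _ /pcat3_len -> /pcat3_len ->.
by rewrite (shortest_len Hu Hv E).
Qed.
Lemma two_short_pcat3 a b p p' r r' : two_short p p' ->
  pcat3 a p b = Some r -> pcat3 a p' b = Some r' -> two_short r r'.
Proof. move=> H K K' R HR HS; apply: (congr_cat HR) K K'; exact: H. Qed.
Lemma two_short_gen u v : shortest u -> shortest v -> connect_same u v ->
  (plen u <= 2)%N -> two_short u v.
Proof. by move=> Hu Hv E L R HR; apply. Qed.

Lemma two_short_pcat p p' q q' r r' : two_short p p' -> two_short q q' ->
  pcat p q = Some r -> pcat p' q' = Some r' -> two_short r r'.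
Proof.
move=> Hp Hq Hr Hr'.
have [E1 E2] := two_short_ends Hp; have [E3 E4] := two_short_ends Hq.
have [s Hs] : exists s, pcat p' q = Some s.
  by apply: pcat_def; rewrite -E2; case: (pcat_some Hr).
apply: (@two_short_trans s).
  apply: (two_short_pcat3 Hp (a := ptriv (pstart p)) (b := q)); apply/pcat3P.
    by exists p => //; exact: (pcat_ptriv p p).2.
  by exists p' => //; rewrite E1; exact: (pcat_ptriv p' p').2.
apply: (two_short_pcat3 Hq (a := p') (b := ptriv (pend q))); apply/pcat3Pr.
  by exists q => //; exact: (pcat_ptriv q q).1.
by exists q' => //; rewrite E4; exact: (pcat_ptriv q' q').1.
Qed.

Lemma two_short_shortest p q : two_short p q -> shortest p = shortest q.
Proof.
by move=> H; rewrite /shortest (two_short_len H); have [-> ->] := two_short_ends H.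
Qed.

Lemma two_short_quasi p q : two_short p q -> quasi_reducible2 p -> quasi_reducible2 q.
Proof.
by move=> H [r [Hr Rr]]; exists r; split=> //; apply: two_short_trans Hr; exact: two_short_sym.
Qed.

(** Both length and distance of ends are invariant under the congruence, hence so
    is the property of being shortest. *)
Lemma quasi_long p : quasi_reducible2 p -> long p.
Proof. by move=> [q [Hq [Lq _]]]; rewrite (two_short_shortest Hq). Qed.

Lemma reducible2_cat a b u p : long u -> plen u = 2%N -> pcat3 a u b = Some p -> reducible2 p.
Proof.
move=> Lu l2 K; split; first by apply: contra Lu; exact: shortest_sub K.
by exists u; split; [exact: pcat3_subpath K| |rewrite l2].
Qed.

(** Quasi-reducible paths form a two-sided ideal: the move to a 2-reducible path
    and the long subpath of length 2 both survive extension. *)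
Lemma quasi_pcat3 a b p r : quasi_reducible2 p -> pcat3 a p b = Some r -> quasi_reducible2 r.
Proof.
move=> [q [Hq [Lq [u [Su Lu l2]]]]] K.
have [s Hs] := pcat3_ends (two_short_ends Hq) K.
exists s; split; first exact: two_short_pcat3 K Hs.
have [c [d Hc]] := subpathP Su.
have [c' [d' [_ [_ H]]]] := pcat3_comp Hc Hs.
by apply: reducible2_cat H => //; exact: long_len2.
Qed.

Lemma quasi_pcatl p q r : quasi_reducible2 p -> pcat p q = Some r -> quasi_reducible2 r.
Proof.
move=> Hp Hr; apply: (quasi_pcat3 (a := ptriv (pstart p)) (b := q) Hp).
by apply/pcat3P; exists p => //; exact: (pcat_ptriv p p).2.
Qed.

Lemma quasi_pcatr p q r : quasi_reducible2 q -> pcat p q = Some r -> quasi_reducible2 r.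
Proof.
move=> Hp Hr; apply: (quasi_pcat3 (a := p) (b := ptriv (pend q)) Hp).
by apply/pcat3Pr; exists q => //; exact: (pcat_ptriv q q).1.
Qed.

Lemma puncons p : (0 < plen p)%N -> exists f m, pcat f m = Some p /\ plen f = 1%N.
Proof.
case: p => [[x [|y s]]] //= P _; rewrite /=.
have /andP[Pxy Ps] := P.
have Pf : path (@arrow G) (x, [:: y]).1 (x, [:: y]).2 by rewrite /= Pxy.
exists (GPath Pf), (@GPath G (y, s) Ps); split=> //.
rewrite /pcat /= eqxx; case: insubP => [r _ E|/=]; last by rewrite P.
by congr Some; apply: val_inj; rewrite E.
Qed.

End PathCongruence.

(** * Quadraticity of the distance algebra *)

Section Quadratic.
Variables (K : fieldType) (G : digraph).
Local Notation KG := (path_alg K G).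
Implicit Types (p q r u v a b : gpath G) (x y : KG).

Definition sigma2 (y : KG) : Prop := gr 2 y /\ sigma_ideal K G y.

Lemma pbas_pcat3 a p b r : pcat3 a p b = Some r ->
  pbas K a * pbas K p * pbas K b = pbas K r.
Proof. by case/pcat3P => ap H1 H2; rewrite pbasM H1 pbasM H2. Qed.

Lemma sigma_ideal_diff p q : shortest p -> shortest q -> connect_same p q ->
  sigma_ideal K G (pbas K p - pbas K q).
Proof. by move=> Hp Hq E; apply: ideal_gen_sub; left; exists p, q. Qed.

Lemma sigma_ideal_long p : long p -> sigma_ideal K G (pbas K p).
Proof. by move=> Hp; apply: ideal_gen_sub; right; exists p. Qed.

Lemma two_short_sigma2 p q : two_short p q -> ideal_gen sigma2 (pbas K p - pbas K q).
Proof.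
have HI := ideal_gen_ideal sigma2; have [I0 ID IM] := HI.
apply: (@two_short_ind _ (fun p q => ideal_gen sigma2 (pbas K p - pbas K q))).
- by move=> r; rewrite subrr.
- by move=> r s H; rewrite -opprB; exact: idealN HI H.
- by move=> r s t H1 H2; rewrite -(subrKA (pbas K s)); exact: ID.
move=> a b u v r s Hu Hv E l2 /pbas_pcat3 <- /pbas_pcat3 <-.
rewrite -mulrBl -mulrBr; apply: IM; apply: ideal_gen_sub; split.
  by apply: grB; rewrite -l2; [|rewrite (shortest_len Hu Hv E)]; exact: gr_pbas.
exact: sigma_ideal_diff.
Qed.

Lemma quasi_sigma2 p : quasi_reducible2 p -> ideal_gen sigma2 (pbas K p).
Proof.
move=> [q [Hq [Lq [u [/subpathP[a [b K3]] Lu l2]]]]].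
have HI := ideal_gen_ideal sigma2; have [I0 ID IM] := HI.
rewrite -(subrK (pbas K q) (pbas K p)); apply: ID; first exact: two_short_sigma2.
rewrite -(pbas_pcat3 K3); apply: IM; apply: ideal_gen_sub; split.
  by rewrite -(long_len2 Lu l2); exact: gr_pbas.
exact: sigma_ideal_long.
Qed.

(** Property (V_2) makes every generator of the ideal of sigma G a consequence of
    quadratic ones: differences along the 2-short congruence telescope into moves,
    and a 2-reducible path is a multiple of a long path of length 2. *)
Lemma V2_quadratic : property_V2 G -> quadratic (sigma_pres K G).
Proof.
move=> [Va Vb] x; split; last first.
  move=> Hx; apply: (Hx (sigma_ideal K G)); first exact: hidealP.
  by move=> s [].
move/(_ (ideal_gen sigma2)); apply; first exact: ideal_gen_ideal.
move=> s [[p [q [Hp Hq E ->]]]|[p Hp ->]]; first by apply: two_short_sigma2; exact: Va.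
by apply: quasi_sigma2; exact: Vb.
Qed.

Section ClassCoefficient.
Variable c : gpath G.

Definition class_part0 (p : path_basis G) : galg K (path_basis G) :=
  if `[< two_short p c >] then pbas K c else 0.
(** This is c times the sum of the coefficients of x over the class of c. Values in
    the path algebra, rather than in K, make it an instance of linear extension of
    maps on basis elements. *)
Definition class_part (x : KG) : KG := bext class_part0 x.

Lemma class_partD x y : class_part (x + y) = class_part x + class_part y.
Proof. exact: bextD. Qed.
Lemma class_partB x y : class_part (x - y) = class_part x - class_part y.
Proof. exact: bextB. Qed.
Lemma class_part_0 : class_part 0 = 0. Proof. exact: bext0. Qed.
Lemma class_partZ k x : class_part (kin k * x) = kin k * class_part x.
Proof. exact: bextZ. Qed.
Lemma class_partU p : class_part (pbas K p) = class_part0 p. Proof. exact: bextU. Qed.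
Lemma class_part_sum (J : Type) (s : seq J) (P : pred J) (F : J -> KG) :
  class_part (\sum_(j <- s | P j) F j) = \sum_(j <- s | P j) class_part (F j).
Proof. exact: bext_sum. Qed.

Lemma class_part_eq p q : two_short p q -> class_part (pbas K p) = class_part (pbas K q).
Proof.
move=> H; rewrite !class_partU /class_part0; congr (if _ then _ else _).
apply: asbool_equiv_eq; split; apply: two_short_trans => //; exact: two_short_sym.
Qed.

Lemma pbas_neq0 p : pbas K p <> 0.
Proof.
move/(congr1 (@coef K (path_basis G) p)); rewrite coef_bas Defs.coef0 eqxx.
by move/eqP; rewrite oner_eq0.
Qed.

Lemma class_part_self p : class_part (pbas K p) = class_part (pbas K c) -> two_short p c.
Proof.
rewrite !class_partU /class_part0; case: asboolP => // _.
case: asboolP => [_ /esym /pbas_neq0 //|[]]; exact: two_short_refl.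
Qed.

Lemma class_part_self0 : class_part (pbas K c) <> 0.
Proof.
rewrite class_partU /class_part0; case: asboolP => [_|[]]; first exact: pbas_neq0.
exact: two_short_refl.
Qed.

Hypothesis irreducible_c : ~ quasi_reducible2 c.

Lemma class_part_quasi p : quasi_reducible2 p -> class_part (pbas K p) = 0.
Proof.
by move=> Hp; rewrite class_partU /class_part0; case: asboolP => // /two_short_quasi /(_ Hp).
Qed.

Lemma pbas_sandwich a p b : pbas K a * pbas K p * pbas K b =
  if pcat3 a p b is Some r then pbas K r else 0.
Proof.
rewrite pbasM /pcat3; case: (pcat a p) => [ap|] /=; last by rewrite mul0r.
by rewrite pbasM.
Qed.

Lemma class_part_sandwich_same a b u v : shortest u -> shortest v -> connect_same u v ->
  plen u = 2%N ->
  class_part (pbas K a * pbas K u * pbas K b) = class_part (pbas K a * pbas K v * pbas K b).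
Proof.
move=> Hu Hv E l2; rewrite !pbas_sandwich.
have Huv : two_short u v by apply: two_short_gen => //; rewrite l2.
case Er: (pcat3 a u b) => [r|].
  have [r' Er'] := pcat3_ends E Er; rewrite Er'.
  by apply: class_part_eq; exact: two_short_pcat3 Huv Er Er'.
case Er': (pcat3 a v b) => [r'|] //.
by have [r] := pcat3_ends (two_short_ends (two_short_sym Huv)) Er'; rewrite Er.
Qed.

Lemma class_part_sandwich_long a b u : long u -> plen u = 2%N ->
  class_part (pbas K a * pbas K u * pbas K b) = 0.
Proof.
move=> Lu l2; rewrite pbas_sandwich; case Er: (pcat3 a u b) => [r|]; last exact: class_part_0.
apply: class_part_quasi; exists r; split; [exact: two_short_refl|exact: reducible2_cat Er].
Qed.

(** Multiplied by a and b, a long path of length 2 leaves the class of c because c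
    is not quasi-reducible, and shortest paths of length 2 with the same ends stay
    congruent. So the functional depends on s only through its image in sigma G,
    which vanishes. *)
Lemma class_part_sigma2_pbas a b s : sigma2 s -> class_part (pbas K a * s * pbas K b) = 0.
Proof.
case=> Gs /sigma_ideal_ker E.
(* slift replaces each shortest path of s by a chosen one with the same ends and
   kills the long ones. *)
transitivity (class_part (pbas K a * slift (sproj s) * pbas K b)); last first.
  by rewrite E slift_0 mulr0 mul0r class_part_0.
rewrite {2}[s]KG_sumE [in LHS](KG_sumE s) sproj_sum slift_sum.
rewrite !mulr_sumr !mulr_suml !class_part_sum big_seq [RHS]big_seq.
apply: eq_bigr => u /((grP 2 s).1 Gs) l2.
rewrite sprojZ sliftZ !kin_swap -!mulrA !class_partZ !mulrA; congr (_ * _).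
rewrite sprojU /sproj0; case: ifP => Hu; last first.
  by rewrite slift_0 mulr0 mul0r class_part_0;
     apply: class_part_sandwich_long => //; rewrite Hu.
rewrite sliftU /slift0; have [H1 [H2 H3]] := slift_ends Hu.
by apply: class_part_sandwich_same => //; split; rewrite ?H2 ?H3.
Qed.

Lemma class_part_sigma2 x y s : sigma2 s -> class_part (x * s * y) = 0.
Proof.
move=> Hs; elim/KG_ind: x => [|x x' Hx Hx'|k a]; first by rewrite !mul0r class_part_0.
  by rewrite !mulrDl class_partD Hx Hx' addr0.
rewrite -!mulrA class_partZ !mulrA; set z := class_part _; suff -> : z = 0 by rewrite mulr0.
rewrite {}/z; elim/KG_ind: y => [|y y' Hy Hy'|l b]; first by rewrite mulr0 class_part_0.
  by rewrite mulrDr class_partD Hy Hy' addr0.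
by rewrite kin_swap class_partZ class_part_sigma2_pbas // mulr0.
Qed.

(** Elements killed by the functional under all two-sided multiplications form an
    ideal, so it is enough to consider generators. *)
Lemma class_part_ideal x : ideal_gen sigma2 x -> class_part x = 0.
Proof.
move=> Hx; rewrite -[x]mul1r -[1 * x]mulr1.
pose I x := forall a b : KG, class_part (a * x * b) = 0.
apply: (Hx I); first split.
- by move=> a b; rewrite mulr0 mul0r class_part_0.
- by move=> y z Hy Hz a b; rewrite mulrDr mulrDl class_partD Hy Hz addr0.
- by move=> a y b Hy a' b'; rewrite !mulrA -(mulrA _ b b').
by move=> s Hs a b; exact: class_part_sigma2.
Qed.

End ClassCoefficient.

(** A class of paths that are not quasi-reducible is detected by its functional,
    which vanishes on the ideal generated in degree 2. If that ideal is the full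
    ideal of relations, it contains the differences of shortest paths and the long
    paths, whence both halves of (V_2). *)
Lemma quadratic_V2 : quadratic (sigma_pres K G) -> property_V2 G.
Proof.
move=> Q; split.
  move=> p q Hp Hq [E1 E2]; apply: two_short_sym.
  have : ideal_gen sigma2 (pbas K q - pbas K p).
    by apply: (Q _).1; apply: sigma_ideal_diff.
  move/(@class_part_ideal p); rewrite class_partB => /(_ _) H.
  apply: class_part_self; apply/eqP; rewrite -subr_eq0 H //.
  by move/quasi_long; rewrite Hp.
move=> p Lp; apply: contrapT => /class_part_ideal H; apply: (@class_part_self0 p); apply: H.
by apply: (Q _).1; apply: sigma_ideal_long.
Qed.

End Quadratic.

(** * Magnitude chains of degree at most 3 *)

Section MagnitudeChains.
Variables (G : digraph) (l : nat).
Implicit Types (x y z w : G).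

(** Reading a vertex list that is not a generator of norm l as zero spares a
    separate treatment of the faces that vanish in the differential. *)
Definition chain (n : nat) (s : seq G) : MC G n l :=
  [ffun u => (tval (val u) == s)%:R].

Lemma chain_eq0 n s : (forall u : mc_gen G n l, tval (val u) <> s) -> chain n s = 0.
Proof. by move=> H; apply/ffunP => u; rewrite !ffunE; case: eqP => // /H. Qed.

Lemma chain_gen n (t u : mc_gen G n l) : chain n (val t) u = (u == t)%:R.
Proof. by rewrite ffunE. Qed.

Lemma chain_sumE n (c : MC G n l) : c = \sum_(t : mc_gen G n l) chain n (val t) *~ c t.
Proof.
apply/ffunP => u; rewrite sum_ffunE (bigD1 u) //= big1 ?addr0 => [|t tu].
  by rewrite ffunMzE chain_gen eqxx -[RHS]/(_ *~ _) intz.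
by rewrite ffunMzE chain_gen eq_sym (negbTE tu) mul0rz.
Qed.

Lemma face_eq n (i : 'I_n.+2) (t : mc_gen G n.+1 l) u :
  (face i t == Some u) = (tval (val u) == del i (val t)).
Proof.
rewrite /face; case: insubP => [v _ E|H].
  by rewrite (inj_eq Some_inj) -val_eqE E eq_sym.
apply/esym/eqP => /val_inj E; move: H; rewrite -E; by rewrite (valP u).
Qed.

Lemma MCd_chain n (t : mc_gen G n.+1 l) :
  MCd (chain n.+1 (val t)) = \sum_(i < n.+2) chain n (del i (val t)) *~ (-1) ^+ i.
Proof.
apply/ffunP => u; rewrite ffunE sum_ffunE (bigD1 t) //= [X in _ + X]big1 ?addr0.
  rewrite big_mkcond; apply: eq_bigr => i _.
  rewrite chain_gen eqxx mulr1 face_eq ffunMzE ffunE.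
  by case: ifP => _; rewrite ?mul0rz // intz.
move=> v vt; apply: big1 => i _; by rewrite chain_gen (negbTE vt) mulr0.
Qed.


Lemma dist_gt0 x y a : dist x y = Some a -> (0 < a)%N = (x != y).
Proof.
move=> E; case: posnP => [a0|a0].
  by rewrite (@dist0 _ x y) ?eqxx // E a0.
by apply/esym; apply: contraTneq a0 => xy; move: E; rewrite xy distxx => -[<-].
Qed.

Lemma chain2_gen x y z a b : dist x y = Some a -> dist y z = Some b ->
  x != y -> y != z -> (a + b)%N = l ->
  exists t : mc_gen G 2 l, tval (val t) = [:: x; y; z].
Proof.
move=> Ea Eb xy yz E.
have P : mc_tuple l [tuple x; y; z].
  by rewrite /mc_tuple /= xy yz Ea Eb /= addn0 E eqxx.
by exists (exist _ [tuple x; y; z] P).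
Qed.

Lemma chain3_gen x y z w a b c : dist x y = Some a -> dist y z = Some b ->
  dist z w = Some c -> x != y -> y != z -> z != w -> (a + b + c)%N = l ->
  exists t : mc_gen G 3 l, tval (val t) = [:: x; y; z; w].
Proof.
move=> Ea Eb Ec xy yz zw E.
have P : mc_tuple l [tuple x; y; z; w].
  by rewrite /mc_tuple /= xy yz zw Ea Eb Ec /= addn0 addnA E eqxx.
by exists (exist _ [tuple x; y; z; w] P).
Qed.

Lemma mc_gen1P (t : mc_gen G 1 l) : exists x y,
  [/\ val t = [tuple x; y], x != y & dist x y = Some l].
Proof.
case: t => t /=; case/tupleP: t => x t; case/tupleP: t => y t; rewrite (tuple0 t).
rewrite /mc_tuple /= andbT; case E: (dist x y) => [a|]; last by rewrite andbF.
rewrite /= addn0 => /andP[xy /eqP[al]]; exists x, y; split=> //.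
by rewrite E al.
Qed.

Lemma mc_gen2P (t : mc_gen G 2 l) : exists x y z a b,
  [/\ val t = [tuple x; y; z], x != y, y != z, (a + b)%N = l &
      dist x y = Some a /\ dist y z = Some b].
Proof.
case: t => t /=; case/tupleP: t => x t; case/tupleP: t => y t; case/tupleP: t => z t.
rewrite (tuple0 t) /mc_tuple /= andbT.
case E: (dist x y) => [a|]; last by rewrite andbF.
case F: (dist y z) => [b|]; last by rewrite andbF.
rewrite /= addn0 => /andP[/andP[xy yz] /eqP[al]]; by exists x, y, z, a, b.
Qed.

Lemma mc_gen3P (t : mc_gen G 3 l) : exists x y z w a b c,
  [/\ val t = [tuple x; y; z; w], [/\ x != y, y != z & z != w], (a + b + c)%N = l &
      [/\ dist x y = Some a, dist y z = Some b & dist z w = Some c]].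
Proof.
case: t => t /=; case/tupleP: t => x t; case/tupleP: t => y t; case/tupleP: t => z t.
case/tupleP: t => w t.
rewrite (tuple0 t) /mc_tuple /= andbT.
case E: (dist x y) => [a|]; last by rewrite andbF.
case F: (dist y z) => [b|]; last by rewrite andbF.
case H: (dist z w) => [c|]; last by rewrite andbF.
rewrite /= addn0 addnA => /andP[/and3P[xy yz zw] /eqP[al]].
by exists x, y, z, w, a, b, c.
Qed.

Lemma chain1_eq0 x y a : dist x y = Some a -> a <> l -> chain 1 [:: x; y] = 0.
Proof.
move=> Ea al; apply: chain_eq0 => u.
have [x' [y' [-> _ E]]] := mc_gen1P u; case=> xx yy; move: E.
by rewrite xx yy Ea => -[].
Qed.

Lemma chain2_eq0 x y z a b : dist x y = Some a -> dist y z = Some b ->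
  (a + b)%N <> l -> chain 2 [:: x; y; z] = 0.
Proof.
move=> Ea Eb al; apply: chain_eq0 => u.
have [x' [y' [z' [a' [b' [-> _ _ E [E1 E2]]]]]]] := mc_gen2P u; case=> xx yy zz.
by move: E1 E2; rewrite xx yy zz Ea Eb => -[aa] [bb]; apply: al; rewrite aa bb.
Qed.

(** The outer faces lose a positive distance, so only the middle one can keep the
    norm; it does so exactly when y lies on a shortest path from x to z. *)
Lemma MCd_chain2 x y z a b : dist x y = Some a -> dist y z = Some b ->
  x != y -> y != z -> (a + b)%N = l ->
  MCd (chain 2 [:: x; y; z]) = - chain 1 [:: x; z].
Proof.
move=> Ea Eb xy yz E; have [t Et] := chain2_gen Ea Eb xy yz E.
have a0 : (0 < a)%N by rewrite (dist_gt0 Ea).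
have b0 : (0 < b)%N by rewrite (dist_gt0 Eb).
have {}Et : val t = [tuple x; y; z] by exact: val_inj.
rewrite -[[:: x; y; z]]/(tval [tuple x; y; z]) -Et MCd_chain Et.
rewrite !big_ord_recl big_ord0 /= /del /= !enum_ordSl /= !enum_ord0 /= /tnth /=.
rewrite (chain1_eq0 Ea); last by apply/eqP; rewrite -E -{1}(addn0 a) eqn_add2l eq_sym -lt0n.
rewrite (chain1_eq0 Eb); last by apply/eqP; rewrite -E -{1}(add0n b) eqn_add2r eq_sym -lt0n.
by rewrite !mul0rz add0r !addr0 expr1 mulrN1z.
Qed.


(** As in degree 2, the two outer faces lose norm. Either term on the right may be
    zero. *)
Lemma MCd_chain3 x y z w a b c : dist x y = Some a -> dist y z = Some b ->
  dist z w = Some c -> x != y -> y != z -> z != w -> (a + b + c)%N = l ->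
  MCd (chain 3 [:: x; y; z; w]) = chain 2 [:: x; y; w] - chain 2 [:: x; z; w].
Proof.
move=> Ea Eb Ec xy yz zw E; have [t Et] := chain3_gen Ea Eb Ec xy yz zw E.
have a0 : (0 < a)%N by rewrite (dist_gt0 Ea).
have c0 : (0 < c)%N by rewrite (dist_gt0 Ec).
have {}Et : val t = [tuple x; y; z; w] by exact: val_inj.
rewrite -[[:: x; y; z; w]]/(tval [tuple x; y; z; w]) -Et MCd_chain Et.
rewrite !big_ord_recl big_ord0 /= /del /= !enum_ordSl /= !enum_ord0 /= /tnth /=.
rewrite (chain2_eq0 Eb Ec); last first.
  by apply/eqP; rewrite -E -addnA -{1}(add0n (b + c)%N) eqn_add2r eq_sym -lt0n.
rewrite (chain2_eq0 Ea Eb); last first.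
  by apply/eqP; rewrite -E -{1}(addn0 (a + b)%N) eqn_add2l eq_sym -lt0n.
rewrite !mul0rz add0r !addr0 /bump /= expr1 mulrN1z addrC.
by congr (_ - _); rewrite -[RHS]mulr1z.
Qed.

Definition boundary (c : MC G 2 l) : Prop := exists b : MC G 3 l, MCd b = c.

Lemma boundary0 : boundary 0. Proof. by exists 0; rewrite raddf0. Qed.
Lemma boundaryB c c' : boundary c -> boundary c' -> boundary (c - c').
Proof. by move=> [b <-] [b' <-]; exists (b - b'); rewrite raddfB. Qed.
Lemma boundaryN c : boundary c -> boundary (- c).
Proof. by move=> H; rewrite -sub0r; apply: boundaryB => //; exact: boundary0. Qed.
Lemma boundaryD c c' : boundary c -> boundary c' -> boundary (c + c').
Proof. by move=> H H'; rewrite -[c']opprK; apply: boundaryB => //; exact: boundaryN. Qed.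
Lemma boundaryMz c k : boundary c -> boundary (c *~ k).
Proof. by move=> [b <-]; exists (b *~ k); rewrite raddfMz. Qed.
Lemma boundary_sum (J : Type) (s : seq J) (P : pred J) (F : J -> MC G 2 l) :
  (forall j, P j -> boundary (F j)) -> boundary (\sum_(j <- s | P j) F j).
Proof. by move=> H; apply: big_ind => //; [exact: boundary0|exact: boundaryD]. Qed.

Lemma MH2_eq0P : (forall c : MH G 2 l, c = 0) <->
  (forall c : MC G 2 l, MCd c = 0 -> boundary c).
Proof.
have E0 : \pi_(MH G 2 l)%qT 0 = 0 by exact: raddf0.
split=> [H c Hc|H h].
  have Zc : c \in @mc_cycle G 2 l by apply/eqP.
  have := H (\pi_(MH G 2 l)%qT (Cycle Zc)).
  move/eqP; rewrite -E0 -Quotient.idealrBE subr0.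
  by move/asboolP.
rewrite -(reprK h); apply/eqP; rewrite -E0 -Quotient.idealrBE subr0.
by apply/asboolP; apply: H; apply/eqP; exact: (valP (repr h)).
Qed.

End MagnitudeChains.

(** * From (V_2) to the vanishing of magnitude homology *)

Section Fill.
Variables (G : digraph) (l : nat) (N : G * G -> MC G 2 l).

(** For a suitable N this is a contracting homotopy modulo boundaries. *)
Definition fill (c : MC G 1 l) : MC G 2 l :=
  \sum_(u : mc_gen G 1 l) N (tnth (val u) ord0, tnth (val u) ord_max) *~ c u.

Lemma fill_zmod_morphism : zmod_morphism fill.
Proof.
move=> c c'; rewrite /fill -sumrB; apply: eq_bigr => u _.
by rewrite !ffunE mulrzBr.
Qed.
HB.instance Definition _ := GRing.isZmodMorphism.Build _ _ fill fill_zmod_morphism.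

Lemma fill_chain x y : x != y -> dist x y = Some l -> fill (chain l 1 [:: x; y]) = N (x, y).
Proof.
move=> xy E.
have P : mc_tuple l [tuple x; y] by rewrite /mc_tuple /= xy E /= addn0 eqxx.
have [u Eu] : exists u : mc_gen G 1 l, val u = [tuple x; y] by exists (exist _ [tuple x; y] P).
rewrite -[[:: x; y]]/(tval [tuple x; y]) -Eu /fill (bigD1 u) //= big1 ?addr0 => [|v vu].
  by rewrite chain_gen eqxx Eu.
by rewrite chain_gen (negbTE vu) mulr0z.
Qed.

End Fill.

Section Vanishing.
Variables (G : digraph) (l : nat).
Implicit Types (p q r f m a b u v : gpath G).

Lemma shortest_neq p : shortest p -> (0 < plen p)%N -> pstart p != pend p.
Proof. by move=> /eqP E; rewrite (dist_gt0 E). Qed.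

Lemma dist_long p : long p -> exists2 d, (d < plen p)%N & dist (pstart p) (pend p) = Some d.
Proof.
have [d Hd E] := dist_plen p => Lp; exists d => //; rewrite ltn_neqAle Hd andbT.
by apply: contra Lp => /eqP dl; rewrite /shortest E dl.
Qed.

(** A path of length l bounds the norm of the triple by l, with equality only if
    both pieces are shortest. *)
Lemma cut_long p1 p2 p : pcat p1 p2 = Some p -> plen p = l -> long p1 || long p2 ->
  chain l 2 [:: pstart p; pend p1; pend p] = 0.
Proof.
move=> Ep El L; have [Em _] := pcat_some Ep.
rewrite (pcat_start Ep) (pcat_end Ep).
have [a Ha Ea] := dist_plen p1; have [b Hb Eb] := dist_plen p2.
apply: (chain2_eq0 Ea (b := b)); first by rewrite Em.
apply/eqP; rewrite neq_ltn -El (pcat_len Ep); apply/orP; left.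
case/orP: L => /dist_long [d dl]; [rewrite Ea|rewrite Eb] => -[E].
  by rewrite -addSn leq_add // E.
by rewrite -addnS leq_add // E.
Qed.

(** The tuple with both inner vertices has the two triples as its inner faces when
    the three pieces are shortest. If one piece is long, each of the two cuts has a
    long side, and both triples are zero. *)
Lemma cut_move f m p1 p2 p : pcat f m = Some p1 -> pcat p1 p2 = Some p -> plen p = l ->
  (0 < plen f)%N -> (0 < plen m)%N -> (0 < plen p2)%N ->
  boundary (chain l 2 [:: pstart p; pend f; pend p] -
            chain l 2 [:: pstart p; pend p1; pend p]).
Proof.
move=> E1 Ep El f0 m0 p20.
have [Efm _] := pcat_some E1; have [Em2 _] := pcat_some Ep.
have [m2 E2 Ep'] : exists2 s, pcat m p2 = Some s & pcat f s = Some p.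
  by apply/pcat3Pr/pcat3P; exists p1.
case: (boolP [&& shortest f, shortest m & shortest p2]) => [/and3P[Sf Sm Sp]|].
  exists (chain l 3 [:: pstart p; pend f; pend p1; pend p]).
  rewrite (pcat_start Ep) (pcat_start E1) (pcat_end E1) (pcat_end Ep).
  rewrite (pcat_end E1) in Em2.
  apply: (MCd_chain3 (a := plen f) (b := plen m) (c := plen p2)).
  - by apply/eqP.
  - by rewrite Efm; apply/eqP.
  - by rewrite Em2; apply/eqP.
  - exact: shortest_neq.
  - by rewrite Efm; exact: shortest_neq.
  - by rewrite Em2; exact: shortest_neq.
  - by rewrite -El (pcat_len Ep) (pcat_len E1).
rewrite !negb_and => L; rewrite (cut_long Ep' El) ?(cut_long Ep El) ?subrr.
- exact: boundary0.
- case/or3P: L => [L|L|->]; rewrite ?orbT //; apply/orP; left; apply: contra L.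
    by case/(shortest_cat E1).
  by case/(shortest_cat E1).
- case/or3P: L => [->|L|L]; rewrite ?orbT //; apply/orP; right; apply: contra L.
    by case/(shortest_cat E2).
  by case/(shortest_cat E2).
Qed.

Definition second p : G := head (pstart p) (pval p).2.
(** Cutting p after its first arrow is an arbitrary choice: modulo boundaries any
    other inner vertex gives the same element. *)
Definition path_chain p : MC G 2 l := chain l 2 [:: pstart p; second p; pend p].

Lemma second_pcat f m p : pcat f m = Some p -> plen f = 1%N -> second p = pend f.
Proof.
move=> /pcat_some [_ Ep] /plen1 [Ef _]; by rewrite /second Ep Ef.
Qed.

Lemma path_chain_cut p1 p2 p : pcat p1 p2 = Some p -> plen p = l ->
  (0 < plen p1)%N -> (0 < plen p2)%N ->
  boundary (path_chain p - chain l 2 [:: pstart p; pend p1; pend p]).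
Proof.
move=> Ep El p10 p20; have [f [m [E1 f1]]] := puncons p10.
have [m2 E2 Ep'] : exists2 s, pcat m p2 = Some s & pcat f s = Some p.
  by apply/pcat3Pr/pcat3P; exists p1.
rewrite /path_chain (second_pcat Ep' f1).
case: (posnP (plen m)) => [m0|m0]; last by apply: cut_move E1 Ep El _ m0 p20; rewrite f1.
suff -> : pend p1 = pend f by rewrite subrr; exact: boundary0.
rewrite (pcat_end E1); have [-> _] := pcat_some E1.
by rewrite /pend (plen0 m0).
Qed.

Hypothesis l3 : (2 < l)%N.

(** A move changes a single vertex of the path. As l is at least 3, some other
    inner vertex is left, and cutting there gives the same triple for both paths. *)
Lemma path_chain_two_short p q : two_short p q -> plen p = l ->
  boundary (path_chain p - path_chain q).
Proof.
move=> H El.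
suff [_] : plen p = plen q /\ (plen p = l -> boundary (path_chain p - path_chain q)) by apply.
move: p q H {El}.
apply: two_short_ind.
- by move=> p; split=> // _; rewrite subrr; exact: boundary0.
- move=> p q [E H]; split=> // El; rewrite -opprB; apply/boundaryN/H; by rewrite E.
- move=> p q r [E1 H1] [E2 H2]; split; first by rewrite E1.
  move=> El; rewrite -(subrKA (path_chain q)); apply: boundaryD; first exact: H1.
  by apply: H2; rewrite -E1.
move=> a b u v p q Hu Hv E u2 Kp Kq; split.
  by rewrite (pcat3_len Kp) (pcat3_len Kq) (shortest_len Hu Hv E).
move=> El.
have El' : plen q = l.
  by rewrite -El (pcat3_len Kp) (pcat3_len Kq) (shortest_len Hu Hv E).
have v2 : plen v = 2%N by rewrite -(shortest_len Hu Hv E).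
have [au Hau Hp] := (pcat3P _ _ _ _).1 Kp; have [av Hav Hq] := (pcat3P _ _ _ _).1 Kq.
have Es : pstart p = pstart q.
  by rewrite (pcat_start Hp) (pcat_start Hq) (pcat_start Hau) (pcat_start Hav).
have Ee : pend p = pend q by rewrite (pcat_end Hp) (pcat_end Hq).
suff [y H1 H2] : exists2 y, boundary (path_chain p - chain l 2 [:: pstart p; y; pend p]) &
    boundary (path_chain q - chain l 2 [:: pstart q; y; pend q]).
  rewrite -(subrKA (chain l 2 [:: pstart p; y; pend p])); apply: boundaryD => //.
  by rewrite -opprB; apply: boundaryN; rewrite Es Ee.
case: (posnP (plen a)) => [a0|a0].
  have b0 : (0 < plen b)%N.
    by move: l3; rewrite -El (pcat3_len Kp) a0 u2; case: (plen b).
  exists (pend au); first by apply: path_chain_cut Hp El _ b0; rewrite (pcat_len Hau) u2 addn2.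
  have [_ E2] := E; have -> : pend au = pend av by rewrite (pcat_end Hau) (pcat_end Hav).
  by apply: path_chain_cut Hq El' _ b0; rewrite (pcat_len Hav) v2 addn2.
have [ub Hub Hp'] := (pcat3Pr _ _ _ _).1 Kp; have [vb Hvb Hq'] := (pcat3Pr _ _ _ _).1 Kq.
exists (pend a); first by apply: path_chain_cut Hp' El a0 _; rewrite (pcat_len Hub) u2.
by apply: path_chain_cut Hq' El' a0 _; rewrite (pcat_len Hvb) v2.
Qed.

(** Since l is at least 3, one end of the long subpath is an inner vertex of p;
    cutting there leaves a long piece. *)
Lemma path_chain_reducible p : reducible2 p -> plen p = l -> boundary (path_chain p).
Proof.
move=> [_ [u [/subpathP[a [b K]] Lu u2]]] El; have {}u2 := long_len2 Lu u2.
have [au Hau Hp] := (pcat3P _ _ _ _).1 K.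
have [ub Hub Hp'] := (pcat3Pr _ _ _ _).1 K.
case: (posnP (plen a)) => [a0|a0].
  have b0 : (0 < plen b)%N.
    by move: l3; rewrite -El (pcat3_len K) a0 u2; case: (plen b).
  rewrite -[path_chain p]subr0 -(cut_long Hp El).
    by apply: path_chain_cut Hp El _ b0; rewrite (pcat_len Hau) u2 addn2.
  by apply/orP; left; apply: contra Lu => /(shortest_cat Hau) [].
rewrite -[path_chain p]subr0 -(cut_long Hp' El).
  by apply: path_chain_cut Hp' El a0 _; rewrite (pcat_len Hub) u2.
by apply/orP; right; apply: contra Lu => /(shortest_cat Hub) [].
Qed.

Lemma path_chain_quasi p : quasi_reducible2 p -> plen p = l -> boundary (path_chain p).
Proof.
move=> [q [Hq Rq]] El; rewrite -(subrK (path_chain q) (path_chain p)); apply: boundaryD.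
  exact: path_chain_two_short.
by apply: path_chain_reducible => //; rewrite -(two_short_len Hq).
Qed.

Lemma chain2_path_chain (x y z : G) (d e : nat) : dist x y = Some d -> dist y z = Some e ->
  x != y -> y != z -> (d + e)%N = l ->
  exists p, [/\ pstart p = x, pend p = z, plen p = l &
    boundary (chain l 2 [:: x; y; z] - path_chain p)].
Proof.
move=> Ea Eb xy yz E.
have [p [p1 p2 p3 _]] := dist_path Ea; have [q [q1 q2 q3 _]] := dist_path Eb.
have [r Er] : exists r, pcat p q = Some r by apply: pcat_def; rewrite p2 q1.
have Es : pstart r = x by rewrite (pcat_start Er).
have Ee : pend r = z by rewrite (pcat_end Er).
have El : plen r = l by rewrite (pcat_len Er) p3 q3.
exists r; split=> //; rewrite -opprB; apply: boundaryN.
rewrite -p2 -Es -Ee; apply: path_chain_cut Er El _ _.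
  by rewrite p3 (dist_gt0 Ea).
by rewrite q3 (dist_gt0 Eb).
Qed.

(** The triples of paths with given ends at distance l all agree modulo boundaries,
    so c can be corrected by a combination depending only on MCd c; triples with
    ends at distance less than l come from long paths and are boundaries. *)
Lemma V2_boundary (c : MC G 2 l) : property_V2 G -> MCd c = 0 -> boundary c.
Proof.
move=> [Va Vb] Hc.
have /choice [N HN] : forall xz : G * G, exists n : MC G 2 l, forall p,
    shortest p -> pstart p = xz.1 -> pend p = xz.2 -> plen p = l ->
    boundary (path_chain p - n).
  move=> [x z] /=; case: (pselect (dist x z = Some l)) => [E|E]; last first.
    by exists 0 => p /eqP Ep px pz pl; case: E; rewrite -px -pz Ep pl.
  have [q [q1 q2 q3 Sq]] := dist_path E; exists (path_chain q) => p Sp px pz pl.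
  apply: path_chain_two_short => //; apply: Va => //; by split; rewrite ?px ?pz.
suff : boundary (c + fill N (MCd c)) by rewrite Hc raddf0 addr0.
suff Ht (t : mc_gen G 2 l) :
    boundary (chain l 2 (val t) + fill N (MCd (chain l 2 (val t)))).
  rewrite {1 2}(chain_sumE c) !raddf_sum -big_split.
  apply: boundary_sum => t _; rewrite /= !raddfMz -mulrzDl; apply: boundaryMz; exact: Ht.
have [x [y [z [a [b [-> xy yz E [Ea Eb]]]]]]] := mc_gen2P t.
rewrite [tval _]/= (MCd_chain2 Ea Eb) // raddfN /=.
have [p [px pz pl Hp]] := chain2_path_chain Ea Eb xy yz E.
case: (boolP (shortest p)) => Sp; last first.
  have [d dl Ed] := dist_long Sp; rewrite px pz in Ed.
  rewrite (chain1_eq0 Ed); last by apply/eqP; rewrite -pl neq_ltn dl.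
  rewrite raddf0 subr0 -(subrK (path_chain p) (chain _ _ _)); apply: boundaryD => //.
  by apply: path_chain_quasi pl; exact: Vb.
rewrite fill_chain.
- rewrite -(subrKA (path_chain p)); apply: boundaryD => //; exact: HN.
- by rewrite -px -pz; apply: shortest_neq; rewrite // pl; apply: ltn_trans l3.
by rewrite -px -pz -pl; apply/eqP.
Qed.

End Vanishing.

Lemma V2_MH2 G : property_V2 G -> forall l, l <> 2%N -> forall c : MH G 2 l, c = 0.
Proof.
move=> V l l2; apply/MH2_eq0P => c Hc; case: (ltnP 2 l) => l3.
  exact: V2_boundary.
rewrite [c]chain_sumE big1; first exact: boundary0.
move=> t _; have [x [y [z [a [b [_ xy yz E [Ea Eb]]]]]]] := mc_gen2P t.
case: l2; apply/eqP; rewrite eqn_leq l3 -E (@leq_add 1 1) //.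
  by rewrite (dist_gt0 Ea).
by rewrite (dist_gt0 Eb).
Qed.

(** * From the vanishing of magnitude homology to (V_2) *)

Section ClassFunctional.
Variables (G : digraph) (l : nat) (c : gpath G).
Implicit Types (p q r f m n : gpath G).

(** Only existence of the shortest pieces is required: that their choice does not
    matter holds for pieces shorter than l, by induction. Positive lengths ensure
    that a triple satisfying this is a generator. *)
Definition through (s : seq G) : Prop := exists p q r,
  [/\ shortest p, shortest q, (0 < plen p)%N & (0 < plen q)%N] /\
  [/\ pcat p q = Some r, two_short r c & s = [:: pstart p; pend p; pend q]].

Definition class_count (d : MC G 2 l) : int :=
  \sum_(t : mc_gen G 2 l) d t * `[< through (val t) >]%:R.

Lemma class_count_zmod_morphism : zmod_morphism class_count.
Proof.
move=> d d'; rewrite /class_count -sumrB; apply: eq_bigr => u _.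
by rewrite !ffunE mulrBl.
Qed.
HB.instance Definition _ := GRing.isZmodMorphism.Build _ _ class_count
  class_count_zmod_morphism.

Hypothesis cl : plen c = l.

Lemma class_count_chain s : class_count (chain l 2 s) = `[< through s >]%:R.
Proof.
have [[t Et]|Nt] := pselect (exists t : mc_gen G 2 l, tval (val t) = s).
  rewrite -Et /class_count (bigD1 t) //= big1 ?addr0 => [|u ut].
    by rewrite chain_gen eqxx mul1r.
  by rewrite chain_gen (negbTE ut) mul0r.
rewrite chain_eq0 ?raddf0; last by move=> u Eu; apply: Nt; exists u.
case: asboolP => // -[p [q [r [[Sp Sq p0 q0] [Er Hr Es]]]]]; case: Nt.
have [Em _] := pcat_some Er.
rewrite Es; apply: (chain2_gen (a := plen p) (b := plen q)).
- exact/eqP.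
- by rewrite Em; apply/eqP.
- exact: shortest_neq.
- by rewrite Em; exact: shortest_neq.
by rewrite -(pcat_len Er) (two_short_len Hr).
Qed.

Hypothesis shortest_IH : forall p q, (plen p < l)%N -> shortest p -> shortest q ->
  connect_same p q -> two_short p q.
Hypothesis long_IH : forall p, (plen p < l)%N -> long p -> quasi_reducible2 p.
Hypothesis irreducible_c : ~ quasi_reducible2 c.

(** Take shortest pieces through y and z: p from x to y, m from y to z, n from z
    to w. A shortest path from y to w may be replaced by mn, since they are congruent
    by the hypothesis on shorter paths, and then pm is shortest: otherwise it is
    quasi-reducible, being shorter than l, and c would be quasi-reducible. The
    converse is the mirror image. *)
Lemma through_move (x y z w : G) a b d : dist x y = Some a -> dist y z = Some b ->
  dist z w = Some d -> x != y -> y != z -> z != w -> (a + b + d)%N = l ->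
  through [:: x; y; w] <-> through [:: x; z; w].
Proof.
move=> Ea Eb Ed xy yz zw E.
have a0 : (0 < a)%N by rewrite (dist_gt0 Ea).
have d0 : (0 < d)%N by rewrite (dist_gt0 Ed).
have [m [m1 m2 m3 Sm]] := dist_path Eb.
split=> -[p [q [r [[Sp Sq p0 q0] [Er Hr [px py qw]]]]]]; have [Em _] := pcat_some Er.
  have [n [n1 n2 n3 Sn]] := dist_path Ed.
  have pa : plen p = a by move: Sp; rewrite /shortest -px -py Ea => /eqP[].
  have qbd : plen q = (b + d)%N.
    apply/eqP; rewrite -(eqn_add2l a) addnA E -cl -(two_short_len Hr) (pcat_len Er) pa.
    by rewrite eqxx.
  have [s Es] : exists s, pcat m n = Some s by apply: pcat_def; rewrite m2 n1.
  have Cs : connect_same q s.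
    by split; rewrite ?(pcat_start Es) ?(pcat_end Es) -?Em -?py ?m1 -?qw ?n2.
  have Ss : shortest s.
    by move: Sq; rewrite /shortest (pcat_len Es) m3 n3 qbd; have [-> ->] := Cs.
  have Hs : two_short q s.
    by apply: shortest_IH => //; rewrite qbd -E -addnA -[ltnLHS]add0n ltn_add2r.
  have [r' Er'] : exists r', pcat p s = Some r'.
    by apply: pcat_def; rewrite Em; case: Cs.
  have Hr' : two_short r' c.
    apply: two_short_trans Hr; apply: two_short_pcat Er' Er; first exact: two_short_refl.
    exact: two_short_sym.
  have [t Et Etn] : exists2 t, pcat p m = Some t & pcat t n = Some r'.
    by apply/pcat3P/pcat3Pr; exists s.
  exists t, n, r'; split; last first.
    by split; rewrite // (pcat_start Et) (pcat_end Et) -px m2 n2.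
  split; rewrite ?(pcat_len Et) ?pa ?addn_gt0 ?a0 ?n3 //.
  apply: contrapT => /negP Lt; apply: irreducible_c.
  apply: two_short_quasi Hr' _; apply: quasi_pcatl Etn; apply: long_IH => //.
  by rewrite (pcat_len Et) pa m3 -E -[ltnLHS]addn0 ltn_add2l.
have [n [n1 n2 n3 Sn]] := dist_path Ea.
have qd : plen q = d by move: Sq; rewrite /shortest -Em -py -qw Ed => /eqP[].
have pab : plen p = (a + b)%N.
  apply/eqP; rewrite -(eqn_add2r d) E -cl -(two_short_len Hr) (pcat_len Er) qd.
  by rewrite eqxx.
have [s Es] : exists s, pcat n m = Some s by apply: pcat_def; rewrite n2 m1.
have Cs : connect_same p s.
  by split; rewrite ?(pcat_start Es) ?(pcat_end Es) -?px -?py ?n1 ?m2.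
have Ss : shortest s.
  by move: Sp; rewrite /shortest (pcat_len Es) m3 n3 pab; have [-> ->] := Cs.
have Hs : two_short p s.
  by apply: shortest_IH => //; rewrite pab -E -[ltnLHS]addn0 ltn_add2l.
have [r' Er'] : exists r', pcat s q = Some r'.
  by apply: pcat_def; rewrite -Em; case: Cs.
have Hr' : two_short r' c.
  apply: two_short_trans Hr; apply: two_short_pcat Er' Er; last exact: two_short_refl.
  exact: two_short_sym.
have [t Et Etn] : exists2 t, pcat m q = Some t & pcat n t = Some r'.
  by apply/pcat3Pr/pcat3P; exists s.
exists n, t, r'; split; last first.
  by split; rewrite // (pcat_end Et) n1 n2 -qw.
split; rewrite ?(pcat_len Et) ?qd ?addn_gt0 ?d0 ?n3 ?orbT //.
apply: contrapT => /negP Lt; apply: irreducible_c.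
apply: two_short_quasi Hr' _; apply: quasi_pcatr Etn; apply: long_IH => //.
by rewrite (pcat_len Et) qd m3 -E -addnA -[ltnLHS]add0n ltn_add2r.
Qed.

(** On a generator of degree 3 only the inner faces matter; they come with opposite
    signs and are counted equally. *)
Lemma class_count_boundary (d : MC G 2 l) : boundary d -> class_count d = 0.
Proof.
suff Ht (t : mc_gen G 3 l) : class_count (MCd (chain l 3 (val t))) = 0.
  move=> [b <-]; rewrite (chain_sumE b) !raddf_sum big1 // => t _.
  by rewrite !raddfMz /= Ht mul0rz.
have [x [y [z [w [a [b' [d' [-> [xy yz zw] E [Ea Eb Ed]]]]]]]]] := mc_gen3P t.
rewrite [tval _]/= (MCd_chain3 Ea Eb Ed) // raddfB /= !class_count_chain.
rewrite (_ : `[< through [:: x; y; w] >] = `[< through [:: x; z; w] >]) ?subrr //.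
by apply: asbool_equiv_eq; apply: through_move Ea Eb Ed _ _ _ E.
Qed.

End ClassFunctional.

Section VanishingV2.
Variable G : digraph.
Implicit Types (p q r f m : gpath G).
Hypothesis MH2_boundary : forall l, l <> 2%N -> forall d : MC G 2 l, MCd d = 0 -> boundary d.

(** The triple of a path p of length l is counted by the functional of p. For two
    shortest paths with the same ends the difference of triples is a cycle, hence a
    boundary, hence not counted by the functional of p: the second path must lie in
    the class of p. For a long path p whose part after the first arrow is shortest,
    the triple itself is a cycle, so it would be a boundary that is counted, unless
    p is quasi-reducible; if that part is long, the induction hypothesis applies. *)
Lemma V2_step l : (2 < l)%N ->
  (forall p q, (plen p < l)%N -> shortest p -> shortest q ->
    connect_same p q -> two_short p q) ->
  (forall p, (plen p < l)%N -> long p -> quasi_reducible2 p) ->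
  (forall p q, plen p = l -> shortest p -> shortest q -> connect_same p q -> two_short p q) /\
  (forall p, plen p = l -> long p -> quasi_reducible2 p).
Proof.
move=> l3 IHa IHb.
have l2 : l <> 2%N by move=> E; rewrite E in l3.
have first_step p : plen p = l -> exists f m,
    [/\ pcat f m = Some p, plen f = 1%N & (plen m).+1 = l].
  move=> pl; have [|f [m [E f1]]] := @puncons _ p; first by rewrite pl; apply: ltn_trans l3.
  by exists f, m; split=> //; rewrite -pl (pcat_len E) f1.
have first_arrow f m p : pcat f m = Some p -> plen f = 1%N -> (plen m).+1 = l -> shortest m ->
    [/\ dist (pstart p) (pend f) = Some 1%N, dist (pend f) (pend p) = Some (plen m),
        pstart p != pend f, pend f != pend p & through p [:: pstart p; pend f; pend p]].
  move=> E f1 ml Sm; have [Em _] := pcat_some E.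
  have Sf : shortest f by apply: shortest_low; rewrite f1.
  have m0 : (0 < plen m)%N by rewrite -ltnS ml; apply: ltn_trans l3.
  rewrite (pcat_start E) (pcat_end E); split.
  - by rewrite -f1; apply/eqP.
  - by rewrite Em; apply/eqP.
  - by apply: shortest_neq; rewrite // f1.
  - by rewrite Em; exact: shortest_neq.
  exists f, m, p; split; split=> //; [by rewrite f1|exact: two_short_refl].
have first_arrow_bd f m p : pcat f m = Some p -> plen f = 1%N -> (plen m).+1 = l ->
    shortest m ->
    MCd (chain l 2 [:: pstart p; pend f; pend p]) = - chain l 1 [:: pstart p; pend p].
  move=> E f1 ml Sm; have [D1 D2 N1 N2 _] := first_arrow _ _ _ E f1 ml Sm.
  by apply: MCd_chain2 D1 D2 _ _ _.
split=> [p q pl Sp Sq E|p pl Lp].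
  have ql : plen q = l by rewrite -(shortest_len Sp Sq E).
  have [f [m [Hp f1 ml]]] := first_step p pl.
  have [g [n [Hq g1 nl]]] := first_step q ql.
  have [_ Sm] := shortest_cat Hp Sp; have [_ Sn] := shortest_cat Hq Sq.
  have [_ _ _ _ Tp] := first_arrow _ _ _ Hp f1 ml Sm.
  have Np : ~ quasi_reducible2 p by move/quasi_long; rewrite Sp.
  have : boundary (chain l 2 [:: pstart p; pend f; pend p] -
                   chain l 2 [:: pstart q; pend g; pend q]).
    apply: MH2_boundary => //; rewrite raddfB /=.
    rewrite (first_arrow_bd f m) // (first_arrow_bd g n) //.
    by have [-> ->] := E; rewrite subrr.
  move/(class_count_boundary pl IHa IHb Np); rewrite raddfB /= !class_count_chain //.
  case: asboolP => // _; case: asboolP => [|//].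
  move=> [p1 [p2 [r [[S1 S2 _ _] [Er Hr [E1 E2 E3]]]]]] _.
  apply: two_short_sym; apply: two_short_trans Hr.
  have [Em1 _] := pcat_some Hq; have [Em2 _] := pcat_some Er.
  apply: (two_short_pcat _ _ Hq Er); apply: IHa => //.
  - by rewrite g1; apply: ltn_trans l3.
  - by case: (shortest_cat Hq Sq).
  - by split; rewrite // -(pcat_start Hq).
  - by rewrite -nl.
  by split; rewrite -?Em1 -?Em2 // -(pcat_end Hq).
have [f [m [Hp f1 ml]]] := first_step p pl.
case: (boolP (shortest m)) => Sm; last first.
  by apply: quasi_pcatr Hp; apply: IHb => //; rewrite -ml.
apply: contrapT => Np; have [_ _ _ _ Tp] := first_arrow _ _ _ Hp f1 ml Sm.
have : boundary (chain l 2 [:: pstart p; pend f; pend p]).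
  apply: MH2_boundary => //; rewrite (first_arrow_bd f m) //.
  have [d dl Ed] := dist_long Lp.
  by rewrite (chain1_eq0 Ed) ?oppr0 //; apply/eqP; rewrite -pl neq_ltn dl.
move/(class_count_boundary pl IHa IHb Np); rewrite class_count_chain //.
by case: asboolP.
Qed.

Lemma vanishing_V2 : property_V2 G.
Proof.
suff H l : (forall p q, (plen p < l)%N -> shortest p -> shortest q ->
    connect_same p q -> two_short p q) /\
    (forall p, (plen p < l)%N -> long p -> quasi_reducible2 p).
  split=> [p q|p].
    by case: (H (plen p).+1) => Ha _; exact: Ha.
  by case: (H (plen p).+1) => _ Hb; exact: Hb.
elim: l => [|l [IHa IHb]]; first by split.
case: (ltnP 2 l) => l3.
  have [Ha Hb] := V2_step l3 IHa IHb.
  split=> [p q|p]; rewrite ltnS leq_eqVlt => /orP[/eqP|].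
  - exact: Ha.
  - exact: IHa.
  - exact: Hb.
  - exact: IHb.
(* In length at most 2 a shortest path is a generator of the congruence and a long
   path is its own long subpath. *)
split=> [p q|p]; rewrite ltnS => pl.
  by move=> Sp Sq E; apply: two_short_gen => //; exact: leq_trans l3.
move=> Lp; exists p; split; first exact: two_short_refl.
split=> //; exists p; split=> //; last exact: leq_trans l3.
exact: pcat3_subpath (pcat3_triv p).
Qed.

End VanishingV2.

(** * The quadratic dual and path cochains *)

Section OppositePaths.
Variable G : digraph.
Local Notation Gop := (opdigraph G).

Lemma verts_oppath (p : gpath G) : verts (oppath p) = rev (verts p) :> seq G.
Proof. by rewrite /verts /= [in RHS]lastI rev_rcons. Qed.

Lemma pend_oppath (p : gpath G) : pend (oppath p) = pstart p.
Proof.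
case: p => [[x [|y s]] P] //.
by rewrite /pend /= rev_cons last_rcons.
Qed.

Lemma plen_oppath (p : gpath G) : plen (oppath p) = plen p.
Proof. by rewrite /plen /= size_rev size_belast. Qed.

Lemma verts_inj (H : digraph) : injective (@verts H).
Proof.
move=> p q [E1 E2]; apply: val_inj => /=.
by case: (pval p) (pval q) E1 E2 => ? ? [? ?] /= -> ->.
Qed.

Lemma oppath_surj (r : gpath Gop) : exists p : gpath G, oppath p = r.
Proof.
have P : path (@arrow G) (pend r) (rev (belast (pval r).1 (pval r).2)).
  by rewrite /pend rev_path; exact: pvalP.
exists (@GPath G (pend r, rev (belast (pval r).1 (pval r).2)) P).
apply: verts_inj; rewrite verts_oppath /verts /=.
by rewrite -rev_rcons -lastI revK.
Qed.

Lemma has_path_op (x y : G) n : @has_path Gop x y n = @has_path G y x n.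
Proof.
apply/has_pathP/has_pathP => -[p [<- <- <-]].
  have [q <-] := oppath_surj p.
  by exists q; rewrite pend_oppath plen_oppath.
by exists (oppath p); rewrite pend_oppath plen_oppath.
Qed.

Lemma dist_op (x y : G) : @dist Gop x y = @dist G y x.
Proof.
apply: Defs.opt_eq => d; rewrite !dist_someP has_path_op.
by split=> -[H1 H2]; split=> // n Hn; apply: H2; rewrite ?has_path_op // -has_path_op.
Qed.

Lemma shortest_oppath (p : gpath G) : shortest (oppath p) = shortest p.
Proof. by rewrite /shortest dist_op pend_oppath plen_oppath. Qed.

End OppositePaths.

Section TwoPathSums.
Variables (K : fieldType) (G : digraph).
Local Notation coef := (@coef K (path_basis G)).

(** The generator t_(x,y) of the ideal defining Omega, without any condition on the
    distance. *)
Definition tsum (x y : G) : path_alg K G := \sum_(v : G) tuple3 K x v y.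

Lemma coef_tuple3 (r : gpath G) x v y :
  coef r (tuple3 K x v y) = (pval r == (x, [:: v; y]))%:R.
Proof.
rewrite /tuple3; case: insubP => [p _ Ep|H].
  by rewrite coef_bas -val_eqE /= Ep eq_sym.
by rewrite Defs.coef0; case: eqP => // E; case/negP: H; rewrite -E; exact: pvalP.
Qed.

Lemma galg_coef_sum (r : gpath G) (J : Type) (s : seq J) (P : pred J) (F : J -> path_alg K G) :
  coef r (\sum_(j <- s | P j) F j) = \sum_(j <- s | P j) coef r (F j).
Proof.
by apply: (big_morph (coef r)) => [x y|]; [exact: Defs.coefD|exact: Defs.coef0].
Qed.

Lemma coef_tsum (r : gpath G) x y :
  coef r (tsum x y) = [&& plen r == 2%N, pstart r == x & pend r == y]%:R.
Proof.
rewrite /tsum galg_coef_sum; under eq_bigr do rewrite coef_tuple3.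
case: r => [[z s] P]; rewrite /pstart /pend /plen /=.
case: s P => [|a [|b [|e s]]] P /=;
  try by rewrite big1 // => v _; rewrite xpair_eqE ?eqseq_cons /= ?andbF.
rewrite (bigD1 a) //= big1 ?addr0 => [|v va].
  by rewrite !xpair_eqE !eqseq_cons /= eqxx andbT.
by rewrite !xpair_eqE !eqseq_cons [a == v]eq_sym (negbTE va) /= andbF.
Qed.

Lemma gr_tsum x y : gr 2 (tsum x y).
Proof.
apply/grP => p; rewrite -coef_supp coef_tsum.
by case: (plen p =P 2%N) => [//|_] /=; rewrite eqxx.
Qed.

End TwoPathSums.

Section Dual.
Variables (K : fieldType) (G : digraph).
Local Notation Gop := (opdigraph G).
Local Notation coefG := (@coef K (path_basis G)).
Local Notation coefO := (@coef K (path_basis Gop)).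

Lemma pairingE (x : path_alg K G) (y : path_alg K Gop) :
  pairing x y = lext (fun p : path_basis G => coefO (oppath p) y : K^o) (gval x).
Proof.
rewrite /pairing /lext suppE; apply: eq_bigr => p _; by rewrite Defs.coefE.
Qed.

Lemma pairing_pbas p (y : path_alg K Gop) : pairing (pbas K p) y = coefO (oppath p) y.
Proof. by rewrite pairingE gval_bas /bas lextU. Qed.

Lemma pairingB x x' (y : path_alg K Gop) : pairing (x - x') y = pairing x y - pairing x' y.
Proof. by rewrite !pairingE gvalB linearB.
Qed.

(** Pairing with t_(x,y) sums the coefficients over the paths of length 2 from y to
    x in G, all of them shortest; this is the coefficient of (y,x) in the image in
    sigma G. *)
Lemma omega_rel_orthogonal t : omega_rel t -> orthogonal2 (sigma_pres K G) t.
Proof.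
move=> [x [y [D ->]]]; rewrite -/(tsum K x y); split; first exact: gr_tsum.
rewrite dist_op in D.
move=> s Gs /(@sigma_ideal_ker K G) E.
have Da : @dist G (y, x).1 (y, x).2 != None by rewrite /= D.
have : @coef K (dist_basis G) (DPair Da) (sproj s) = 0 by rewrite E Defs.coef0.
rewrite {1}[s]KG_sumE sproj_sum => <-.
rewrite /pairing.
rewrite (big_morph _ (@Defs.coefD _ _ _) (@Defs.coef0 _ _ _)) big_seq [RHS]big_seq.
apply: eq_bigr => p /((grP 2 s).1 Gs) p2.
rewrite sprojZ coef_kin; congr (_ * _).
rewrite coef_tsum pend_oppath plen_oppath sprojU /sproj0.
have -> : plen p = 2%N by [].
rewrite eqxx andTb -[pstart (oppath p)]/(pend p).
case: (boolP (shortest p)) => Sp; last first.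
  rewrite Defs.coef0; case: andP => // -[/eqP px /eqP py]; case/negP: Sp.
  by rewrite /shortest px py D; apply/eqP; congr Some; exact/esym.
by rewrite coef_bas -val_eqE /= xpair_eqE andbC.
Qed.

(** Orthogonality to differences of shortest paths makes the coefficients of y
    constant on the paths of length 2 with given ends, and orthogonality to long
    paths makes them zero on those with ends at distance less than 2. Hence y is a
    combination of the elements t_(x,y). *)
Lemma orthogonal_omega (y : path_alg K Gop) :
  orthogonal2 (sigma_pres K G) y -> ideal_gen (@omega_rel K Gop) y.
Proof.
move=> [Gy Hy].
have HI := ideal_gen_ideal (@omega_rel K Gop).
have /choice [k Hk] : forall xz : G * G, exists k : K, forall p : gpath G, shortest p ->
    plen p = 2%N -> pend p = xz.1 -> pstart p = xz.2 -> coefO (oppath p) y = k.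
  move=> [x z] /=; have [[p [Sp p2 px pz]]|N] := pselect (exists p : gpath G,
    [/\ shortest p, plen p = 2%N, pend p = x & pstart p = z]); last first.
    by exists 0 => p Sp p2 px pz; case: N; exists p.
  exists (coefO (oppath p) y) => q Sq q2 qx qz.
  apply/eqP; rewrite -subr_eq0 -!pairing_pbas -pairingB; apply/eqP/Hy.
    by apply: grB; [rewrite -q2|rewrite -p2]; exact: gr_pbas.
  by apply: ideal_gen_sub; left; exists q, p; split; rewrite // /connect_same px pz.
suff -> : y = \sum_(xz : G * G | @dist Gop xz.1 xz.2 == Some 2%N)
    kin (k xz) * @tsum K Gop xz.1 xz.2.
  apply: ideal_sum => // -[x z] /eqP /= D; apply: (idealMl _ HI).
  by apply: ideal_gen_sub; exists x, z.
apply: galgP => r; rewrite galg_coef_sum.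
under eq_bigr do rewrite coef_kin coef_tsum.
have [p Ep] := oppath_surj r.
case: (eqVneq (plen r) 2%N) => [r2|r2]; last first.
  rewrite big1 => [|xz _]; last by rewrite mulr0.
  apply/eqP; rewrite -[_ == _]negbK coef_supp; apply: contra r2 => /((grP 2 y).1 Gy) r2.
  exact/eqP.
have p2 : plen p = 2%N by rewrite -plen_oppath Ep.
case: (boolP (shortest p)) => Sp.
  rewrite (bigD1 (pstart r, pend r)) /=; last first.
    by move: Sp; rewrite -shortest_oppath Ep /shortest r2.
  rewrite !eqxx mulr1 big1 ?addr0 => [|[x z] /andP[_]].
    by rewrite -Ep; apply: Hk => //; rewrite pend_oppath.
  rewrite xpair_eqE => /negbTE N.
  by rewrite /= [pstart r == x]eq_sym [pend r == z]eq_sym N mulr0.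
rewrite big1 => [|[x z] /= D].
  rewrite -Ep -pairing_pbas; apply: Hy; first by rewrite -p2; exact: gr_pbas.
  by apply: ideal_gen_sub; right; exists p.
case: andP => [[/eqP rx /eqP rz]|_]; last by rewrite mulr0.
by case/negP: Sp; rewrite -shortest_oppath Ep /shortest rx rz r2.
Qed.

Lemma hideal_eq (A : grAlgType K) (I J : hideal A) : (forall x, I x <-> J x) -> I = J.
Proof.
case: I J => [I I1 I2] [J J1 J2] /= H.
have E : I = J by apply/funext => x; exact/propext.
by case: _ / E J1 J2 => J1 J2; rewrite (Prop_irrelevance I1 J1) (Prop_irrelevance I2 J2).
Qed.

Lemma gr_iso_refl (A : grAlgType K) : gr_iso A A.
Proof. by exists idfun; split=> //; exists idfun. Qed.

(** The two ideals of the path algebra of the opposite digraph coincide. *)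
Lemma qdual_Omega : gr_iso (qdual (sigma_pres K G)) (Omega K Gop).
Proof.
rewrite /qdual /Omega.
rewrite (_ : gen_hideal (@orthogonal2_hom _ _ _ _) = gen_hideal (@omega_rel_hom K Gop)).
  exact: gr_iso_refl.
apply: hideal_eq => y /=; split=> H I HI HS; apply: H => // s Hs.
  exact: (orthogonal_omega Hs HI HS).
apply: HS; exact: omega_rel_orthogonal.
Qed.

End Dual.

Theorem proposition6p4 (G : digraph) :
  ((forall l : nat, l <> 2%N -> forall c : MH G 2 l, c = 0) <-> property_V2 G) /\
  (property_V2 G <-> (forall K : fieldType, quadratic (sigma_pres K G))) /\
  (property_V2 G -> forall K : fieldType,
     gr_iso (qdual (sigma_pres K G)) (Omega K (opdigraph G))).
Proof.
split; [split=> [H|]|split; [split=> [V K|H]|]].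
- apply: vanishing_V2 => l l2 d; have /MH2_eq0P := H l l2; exact.
- exact: V2_MH2.
- exact: V2_quadratic.
- exact: quadratic_V2 (H rat).
by move=> _ K; exact: qdual_Omega.
Qed.
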